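(* Let $1\le d<n$ and let $Z$ be the supremum of a Rademacher chaos of order $d$, with associated quantities $W_1,\dots,W_d$ (all defined in the context). Then for all real $q\ge 2$, $$\|(Z-\mathbb{E}[Z])_+\|_q\le\sum_{j=1}^{d-1}(4\kappa q)^{j/2}\,\mathbb{E}[W_j]+(4\kappa)^{(d-1)/2}\sqrt{2K}\,q^{d/2}\,W_d\le\sum_{j=1}^{d}(4\kappa q)^{j/2}\,\mathbb{E}[W_j] .$$
   Context: $X_1,\dots,X_n$ are independent Rademacher variables ($\mathbb{P}\{X_i=1\}=\mathbb{P}\{X_i=-1\}=1/2$). For $0\le m\le n$, $\mathcal{I}_{n,m}$ is the family of subsets of $\{1,\dots,n\}$ of size $m$. $\mathcal{T}$ is a (nonempty) compact subset of $\mathbb{R}^{\binom nd}$, whose elements $t=(t_I)_{I\in\mathcal{I}_{n,d}}$ are vectors indexed by $\mathcal{I}_{n,d}$. Define $$Z=\sup_{t\in\mathcal{T}}\Bigl|\sum_{I\in\mathcal{I}_{n,d}}\Bigl(\prod_{i\in I}X_i\Bigr)t_I\Bigr|$$ and, for $1\le k\le d$, $$W_k=\sup_{t\in\mathcal{T}}\ \sup_{\substack{\alpha^{(1)},\dots,\alpha^{(k)}\in\mathbb{R}^n\\ \|\alpha^{(h)}\|_2\le1,\ h\le k}}\Bigl|\sum_{J\in\mathcal{I}_{n,d-k}}\Bigl(\prod_{j\in J}X_j\Bigr)\Bigl(\sum_{i_1,\dots,i_k:\ \{i_1,\dots,i_k\}\cup J\in\mathcal{I}_{n,d}}\Bigl(\prod_{h=1}^k\alpha^{(h)}_{i_h}\Bigr)t_{\{i_1,\dots,i_k\}\cup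 J}\Bigr)\Bigr| ,$$ where the inner sum is over ordered tuples $(i_1,\dots,i_k)\in\{1,\dots,n\}^k$ and $\|\cdot\|_2$ is the Euclidean norm. ($W_d$ is deterministic.) Write $x_+=\max(x,0)$, $\|Y\|_q=(\mathbb{E}|Y|^q)^{1/q}$, $\kappa=\frac{\sqrt e}{2(\sqrt e-1)}$ and $K=\frac1{e-\sqrt e}$. *)

(* Defs.v *)
From HB Require Import structures.
From mathcomp Require Import all_boot all_order all_algebra.
From mathcomp Require Import all_classical all_reals all_analysis.

Set Implicit Arguments.
Unset Strict Implicit.
Unset Printing Implicit Defensive.

Import Order.TTheory GRing.Theory Num.Theory.
Import numFieldNormedType.Exports.

Local Open Scope classical_set_scope.
Local Open Scope ring_scope.

(* The coordinates {1, ..., n} are represented by 'I_n = {0, ..., n - 1}. *)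
Definition msubset (n m : nat) := {I : {set 'I_n} | #|I| == m}.

(* R^(n choose d), as functions on the d-subsets with the product topology. *)
Definition coefs (R : realType) (n d : nat) := {ptws msubset n d -> R}.

(* t_S for a set S not packed with a proof that #|S| = d; the default value 0
   is only reached when #|S| != d. *)
Definition coef (R : realType) (n d : nat) (t : coefs R n d)
    (S : {set 'I_n}) : R :=
  oapp (fun I : msubset n d => t I) 0 (insub S).

(* The library's norm on 'rV[R]_n is the sup norm. *)
Definition norm2 (R : realType) (n : nat) (a : 'rV[R]_n) : R :=
  Num.sqrt (\sum_(i < n) a ord0 i ^+ 2).

Definition chaosZ (R : realType) (n d : nat) (TT : set (coefs R n d))
    (x : 'I_n -> R) : R :=
  sup [set `| \sum_(I : msubset n d) (\prod_(i in val I) x i) * t I | | t in TT].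

Definition chaosW (R : realType) (n d : nat) (TT : set (coefs R n d)) (k : nat)
    (x : 'I_n -> R) : R :=
  sup [set
    sup [set
      `| \sum_(J : msubset n (d - k)) (\prod_(j in val J) x j) *
           (\sum_(i : {ffun 'I_k -> 'I_n} |
                  #|[set i h | h : 'I_k] :|: val J| == d)
              (\prod_(h < k) alpha h ord0 (i h)) *
              coef t ([set i h | h : 'I_k] :|: val J)) |
      | alpha in [set a : 'I_k -> 'rV[R]_n | forall h, norm2 (a h) <= 1]]
    | t in TT].

Definition independent_RVs (dO : measure_display) (O : measurableType dO)
    (R : realType) (P : probability O R) (n : nat)
    (X : 'I_n -> {RV P >-> R}) : Prop :=
  forall (J : {set 'I_n}) (B : 'I_n -> set R),
    (forall i, measurable (B i)) ->
    P (\bigcap_(i in [set` J]) (X i @^-1` B i)) =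
      (\prod_(i in J) P (X i @^-1` B i))%E.

Definition rademacher_RV (dO : measure_display) (O : measurableType dO)
    (R : realType) (P : probability O R) (X : {RV P >-> R}) : Prop :=
  P (X @^-1` [set 1]) = (2^-1)%:E /\ P (X @^-1` [set -1]) = (2^-1)%:E.

Definition kappa (R : realType) : R :=
  Num.sqrt (expR 1) / (2 * (Num.sqrt (expR 1) - 1)).

Definition Kconst (R : realType) : R := (expR 1 - Num.sqrt (expR 1))^-1.

(* Main.v *)
Require Import Defs.
From HB Require Import structures.
From mathcomp Require Import all_boot all_order all_algebra.
From mathcomp Require Import all_classical all_reals all_analysis.
From mathcomp Require Import measurable_realfun zify ring lra.

Set Implicit Arguments.
Unset Strict Implicit.
Unset Printing Implicit Defensive.

Import Order.TTheory GRing.Theory Num.Theory.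
Import numFieldNormedType.Exports.

Local Open Scope classical_set_scope.
Local Open Scope ring_scope.

(** The variables X_i are independent signs, so the expectation of any
    nonnegative function of (X_1, ..., X_n) is its average over the cube
    {-1, 1}^n ([integral_rademacher]); the theorem is an inequality between such
    averages, written E below.

    Let Z >= 0 be a function on the cube, Y = (Z - E Z)_+ and
    V = 1/2 sum_i ((Z - Z^i)_+)^2, where Z^i is Z after flipping the i-th sign.
    The entropy method controls the moments of Y by V.  For 1 <= r <= 2 the
    two-point entropy of x^r is jointly convex ([gap_midconvex]), hence the
    entropy E F^r - (E F)^r is at most the sum of its one-coordinate versions
    ([entropy_tensor]).  For F = Y^(q-1) and r = q/(q-1) this reads
      E Y^q <= (E Y^(q-1))^(q/(q-1)) + (q-1) E[Y^(q-2) V]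
    ([excess_recursion]).  Induction on q in unit steps then yields
      ||Y||_q <= sqrt(2 kappa q) ||sqrt V||_q        ([excess_moment_upvar]),
      ||Y||_q <= sqrt(K q C)  whenever V <= C        ([excess_moment_bounded]).
    The constants are those for which the induction step closes: kappa because
    (1 - 1/q)^(q/2) <= e^(-1/2), and K because, in addition,
    (1 - 2/q)^((q-2)/2) tends to e^(-1).

    A chaos is self-bounding along W_0 = Z, W_1, ..., W_d.  Flipping the i-th
    sign changes the form that defines W_k by twice the i-th entry of a vector,
    and pairing that vector with one more unit vector gives the form that
    defines W_(k+1).  Hence V(W_k) <= 2 W_(k+1)^2 ([upvar_chaosW]), and
      ||(W_k - E W_k)_+||_q
        <= sqrt(4 kappa q) ||W_(k+1)||_q
        <= sqrt(4 kappa q) (E W_(k+1) + ||(W_(k+1) - E W_(k+1))_+||_q).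
    Iterating from k = 0 and using the sharper bound at k = d - 1, where
    V(W_k) <= 2 W_d^2 is constant, gives the first inequality
    ([cube_moment_bound]).  The second one is K <= 2 kappa. *)

(** * Convexity inequalities for real powers *)

Lemma powR_le (R : realType) (r x y : R) : 0 <= r -> 0 <= x -> x <= y ->
  x `^ r <= y `^ r.
Proof.
by move=> r0 x0 xy; rewrite ge0_ler_powR ?nnegrE// (le_trans x0 xy).
Qed.

(** Young's inequality for the conjugate exponents 1/t and 1/(1-t). *)
Lemma powR_amgm (R : realType) (x y t : R) :
  0 <= x -> 0 <= y -> 0 <= t <= 1 ->
  x `^ t * y `^ (1 - t) <= t * x + (1 - t) * y.
Proof.
move=> x0 y0 /andP[t0 t1].
have [->|tn0] := eqVneq t 0.
  by rewrite powRr0 subr0 powRr1// mul0r add0r.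
have [->|tn1] := eqVneq t 1.
  by rewrite subrr powRr0 powRr1// mul0r addr0 mulr1 mul1r.
have tp : 0 < t by rewrite lt_neqAle eq_sym tn0.
have sp : 0 < 1 - t by rewrite subr_gt0 lt_neqAle tn1.
have := @conjugate_powR R (x `^ t) (y `^ (1 - t)) t^-1 (1 - t)^-1.
rewrite !powR_ge0 !invr_gt0 !invrK => /(_ isT isT tp sp).
rewrite addrC subrK => /(_ erefl) /le_trans; apply.
rewrite -!powRrM !mulfV ?gt_eqF// !powRr1//.
by rewrite [x * _]mulrC [y * _]mulrC.
Qed.

(** The convex function y^p lies above its tangent at x.  This is the weighted
    arithmetic-geometric inequality between y^p and x^p with weight 1/p, so it
    also holds at x = 0. *)
Lemma powR_tangent (R : realType) (x y p : R) :
  0 <= x -> 0 <= y -> 1 <= p ->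
  x `^ p + p * x `^ (p - 1) * (y - x) <= y `^ p.
Proof.
move=> x0 y0 p1.
have p0 : 0 < p by exact: lt_le_trans p1.
have t01 : 0 <= p^-1 <= 1 by rewrite invr_ge0 ltW//= invf_le1.
have := @powR_amgm R (y `^ p) (x `^ p) p^-1 (powR_ge0 _ _) (powR_ge0 _ _) t01.
rewrite -!powRrM mulfV ?gt_eqF// mulrBr mulr1 mulfV ?gt_eqF// powRr1//.
rewrite -(ler_pM2l p0) mulrDr !mulrA mulfV ?gt_eqF// mul1r.
rewrite mulrBr mulr1 mulfV ?gt_eqF//.
rewrite mulrBr -(mulr_powRB1 x0 p0).
set a := x `^ (p - 1); set b := y `^ p.
by nra.
Qed.

Lemma powR_midconvex (R : realType) (x y p : R) :
  0 <= x -> 0 <= y -> 1 <= p ->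
  2 * ((x + y) / 2) `^ p <= x `^ p + y `^ p.
Proof.
move=> x0 y0 p1; set m := (x + y) / 2.
have m0 : 0 <= m by rewrite /m; lra.
have := powR_tangent m0 x0 p1; have := powR_tangent m0 y0 p1.
have -> : y - m = - (x - m) by rewrite /m; lra.
lra.
Qed.

(** Add the two weighted arithmetic-geometric inequalities that compare x and y
    with their midpoint m, and divide by m^(1-t). *)
Lemma powR_midconcave (R : realType) (x y t : R) :
  0 <= x -> 0 <= y -> 0 <= t <= 1 ->
  x `^ t + y `^ t <= 2 * ((x + y) / 2) `^ t.
Proof.
move=> x0 y0 t01; set m := (x + y) / 2.
have m0 : 0 <= m by rewrite /m; lra.
have [mz|mp] := eqVneq m 0.
  have [-> ->] : x = 0 /\ y = 0 by move: mz; rewrite /m; split; lra.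
  by rewrite mz; lra.
have {}mp : 0 < m by rewrite lt_neqAle eq_sym mp.
have mt : 0 < m `^ (1 - t) by rewrite powR_gt0.
have E : m `^ t * m `^ (1 - t) = m.
  by rewrite -powRD subrKC ?oner_eq0// powRr1.
rewrite -(ler_pM2r mt) -(mulrA 2) E.
have := powR_amgm x0 m0 t01; have := powR_amgm y0 m0 t01.
have tE : t * x + t * y = 2 * (t * m) by rewrite /m; field.
by rewrite mulrDl; lra.
Qed.

(** Midpoint convexity of the second-order form x^s u^2 along a segment: by
    Cauchy-Schwarz (u+v)^2 <= (x^s u^2 + y^s v^2) (x^(-s) + y^(-s)), and the last
    factor is controlled by the concavity of x^(-s). *)
Lemma powR_perspective_midconvex (R : realType) (x y u v s : R) :
  0 < x -> 0 < y -> -1 <= s <= 0 ->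
  2 * ((x + y) / 2) `^ s * ((u + v) / 2) ^+ 2
    <= x `^ s * u ^+ 2 + y `^ s * v ^+ 2.
Proof.
move=> x0 y0 s01; set m := (x + y) / 2.
have m0 : 0 < m by rewrite /m; lra.
have t01 : 0 <= - s <= 1 by lra.
have := powR_midconcave (ltW x0) (ltW y0) t01.
rewrite !powRN -/m.
have : 0 < x `^ s by rewrite powR_gt0.
have : 0 < y `^ s by rewrite powR_gt0.
have : 0 < m `^ s by rewrite powR_gt0.
set A := x `^ s; set B := y `^ s; set M := m `^ s => M0 B0 A0.
rewrite -(ler_pM2l M0) -(ler_pM2l A0) -(ler_pM2l B0).
have -> : B * (A * (M * (A^-1 + B^-1))) = M * (A + B).
  by field; rewrite !gt_eqF.
have -> : B * (A * (M * (2 / M))) = 2 * A * B by field; rewrite gt_eqF.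
move=> H.
have AB : 0 < A + B by lra.
rewrite -(ler_pM2l AB).
apply: (@le_trans _ _ (4 * A * B * ((u + v) / 2) ^+ 2)).
  have := ler_wpM2r (sqr_ge0 ((u + v) / 2)) H; lra.
have := sqr_ge0 (A * u - B * v); rewrite !expr2; lra.
Qed.

(** Applying the mean value theorem on each half of [0, 1], and then to the
    derivative between the two points so obtained. *)
Lemma midconvex_of_derive2_ge0 (R : realType) (g g' g'' : R -> R) :
  (forall x : R, 0 <= x <= 1 -> is_derive x 1 g (g' x)) ->
  (forall x : R, 0 <= x <= 1 -> is_derive x 1 g' (g'' x)) ->
  (forall x : R, 0 <= x <= 1 -> 0 <= g'' x) ->
  2 * g (1 / 2) <= g 0 + g 1.
Proof.
move=> dg dg' g0.
have cont (h h' : R -> R) (a b : R) :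
    (forall x : R, 0 <= x <= 1 -> is_derive x 1 h (h' x)) ->
    0 <= a -> b <= 1 -> {within `[a, b], continuous h}.
  move=> dh a0 b1; apply: derivable_within_continuous => x.
  rewrite in_itv/= => /andP[ax xb].
  by have [] := dh x ltac:(by rewrite (le_trans a0 ax) (le_trans xb b1)).
have mvt (h h' : R -> R) (a b : R) :
    (forall x : R, 0 <= x <= 1 -> is_derive x 1 h (h' x)) ->
    0 <= a -> a < b -> b <= 1 ->
    exists2 c, a < c < b & h b - h a = h' c * (b - a).
  move=> dh a0 ab b1.
  have [|c|c] := @MVT R h h' a b ab; last 2 first.
  - exact: (cont _ _ _ _ dh).
  - by rewrite in_itv => cab ?; exists c.
  move=> x; rewrite in_itv/= => /andP[ax xb]; apply: dh; lra.
have [c2 c2i E2] := mvt _ _ (1/2) 1 dg ltac:(lra) ltac:(lra) ltac:(lra).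
have [|||c1 c1i E1] := mvt _ _ 0 (1/2) dg; [lra..|].
have [d di E3] := mvt _ _ c1 c2 dg' ltac:(lra) ltac:(lra) ltac:(lra).
have gd : 0 <= g'' d by apply: g0; lra.
have : 0 <= g' c2 - g' c1 by rewrite E3 mulr_ge0// subr_ge0; lra.
lra.
Qed.

(** * The two-point entropy of x^r *)

(** This is E F^r - (E F)^r for F taking the values x and y with probability
    1/2 each. *)
Definition gap (R : realType) (r x y : R) : R :=
  (x `^ r + y `^ r) / 2 - ((x + y) / 2) `^ r.

Lemma is_derive_affine_powR (R : realType) (s p u t : R) : 0 < p + t * u ->
  is_derive t 1 (fun t : R => (p + t * u) `^ s) (s * (p + t * u) `^ (s - 1) * u).
Proof.
move=> pos.
have dell : is_derive t 1 (fun t : R => p + t * u) u.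
  by apply: is_derive_eq; rewrite scaler0 add0r /GRing.scale /= mul1r mulr1 add0r.
exact: (@is_derive1_comp R (fun x => x `^ s) (fun t : R => p + t * u) t _ _
          (is_derive1_powR s pos) dell).
Qed.

(** Along the segment from (a, b) to (c, d) the second derivative of the entropy
    is nonnegative by [powR_perspective_midconvex] with s = r - 2; this is where
    r <= 2 is needed.  The function [g k s t] below is chosen so that
    differentiating it raises k and lowers s. *)
Lemma gap_midconvex_pos (R : realType) (r a b c d : R) :
  1 <= r <= 2 -> 0 < a -> 0 < b -> 0 < c -> 0 < d ->
  2 * gap r ((a + c) / 2) ((b + d) / 2) <= gap r a b + gap r c d.
Proof.
move=> /andP[r1 r2] a0 b0 c0 d0.
have pos (p p' t : R) : 0 < p -> 0 < p' -> 0 <= t <= 1 -> 0 < p + t * (p' - p).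
  by move=> ? ? ?; nra.
set u := c - a; set v := d - b; set m := (a + b) / 2; set w := (u + v) / 2.
have wE : w = (c + d) / 2 - m by rewrite /w /m /u /v; field.
pose g (k : nat) (s t : R) :=
   (a + t * u) `^ s * u ^+ k + (b + t * v) `^ s * v ^+ k
   - 2 * ((m + t * w) `^ s * w ^+ k).
have dg k s (t : R) : 0 <= t <= 1 -> is_derive t 1 (g k s) (s * g k.+1 (s - 1) t).
  move=> t01.
  have da := is_derive_affine_powR s (pos a c t a0 c0 t01).
  have db := is_derive_affine_powR s (pos b d t b0 d0 t01).
  have m0 : 0 < m + t * w by rewrite wE; apply: pos => //; rewrite /m; lra.
  have dm := is_derive_affine_powR s m0.
  apply: is_derive_eq.
  rewrite /GRing.scale /= /g !exprS -/u -/v.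
  move: (_ `^ (s - 1)) (_ `^ (s - 1)) (_ `^ (s - 1)) => A B M.
  move: (_ `^ s) (_ `^ s) (_ `^ s) (u ^+ k) (v ^+ k) (w ^+ k) => A' B' M' U V W.
  clearbody u v w; ring.
have midc : 2 * g 0%N r (1 / 2) <= g 0%N r 0 + g 0%N r 1.
  apply: (@midconvex_of_derive2_ge0 R _ _
    (fun t => r * ((r - 1) * g 2%N (r - 1 - 1) t)) (dg 0%N r)).
  - by move=> t t01; have dgt := dg 1%N (r - 1) t t01; apply: is_derive_eq.
  - move=> t t01.
    have a1 := pos _ _ _ a0 c0 t01; have b1 := pos _ _ _ b0 d0 t01.
    apply: mulr_ge0; first exact: le_trans r1.
    apply: mulr_ge0; first by rewrite subr_ge0.
    rewrite /g subr_ge0.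
    have := @powR_perspective_midconvex R _ _ u v (r - 1 - 1) a1 b1.
    have -> : (a + t * (c - a) + (b + t * (d - b))) / 2 = m + t * w.
      by rewrite wE /m; field.
    by rewrite -/u -/v -/w mulrA; apply; lra.
move: midc; rewrite /g !expr0 !mulr1 !mul0r !addr0 !mul1r.
have -> : a + u = c by rewrite /u; ring.
have -> : b + v = d by rewrite /v; ring.
have -> : m + w = (c + d) / 2 by rewrite wE; ring.
have -> : a + 2^-1 * u = (a + c) / 2 by rewrite /u; field.
have -> : b + 2^-1 * v = (b + d) / 2 by rewrite /v; field.
have -> : m + 2^-1 * w = ((a + c) / 2 + (b + d) / 2) / 2.
  by rewrite wE /m; field.
rewrite /gap -/m; lra.
Qed.

(** The points of the quadrant are approached from its interior by adding h to
    all four coordinates; the tangent inequality bounds the error linearly in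
    h. *)
Lemma gap_midconvex (R : realType) (r a b c d : R) :
  1 <= r <= 2 -> 0 <= a -> 0 <= b -> 0 <= c -> 0 <= d ->
  2 * gap r ((a + c) / 2) ((b + d) / 2) <= gap r a b + gap r c d.
Proof.
move=> r12 a0 b0 c0 d0; have [r1 r2] := andP r12; have r0 := le_trans ler01 r1.
(* C is a Lipschitz constant of x^r on [0, s], which contains all arguments. *)
pose s := a + b + c + d + 1.
pose C := r * s `^ (r - 1).
have C0 : 0 <= C by rewrite mulr_ge0 ?powR_ge0.
have up (x e : R) : 0 <= x -> x + e <= s -> 0 <= e ->
    (x + e) `^ r <= x `^ r + C * e.
  move=> x0 xs e0.
  have xe0 : 0 <= x + e by rewrite addr_ge0.
  have := powR_tangent xe0 x0 r1.
  have -> : x - (x + e) = - e by ring.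
  rewrite mulrN lerBlDr => /le_trans; apply; rewrite lerD2l ler_wpM2r//.
  rewrite ler_wpM2l// ge0_ler_powR// ?nnegrE ?subr_ge0//.
  exact: le_trans xs.
have dn (x e : R) : 0 <= x -> 0 <= e -> x `^ r <= (x + e) `^ r.
  by move=> x0 e0; rewrite ge0_ler_powR// ?nnegrE ?addr_ge0// lerDl.
rewrite -subr_ge0; apply/ler_addgt0Pl => e e0.
pose h := Num.min 1 (e / (4 * C + 1)).
have C1 : 0 < 4 * C + 1 by lra.
have h0 : 0 < h by rewrite lt_min ltr01 divr_gt0.
have h1 : h <= 1 by rewrite ge_min lexx.
have hC : 4 * (C * h) <= e.
  have : h * (4 * C + 1) <= e by rewrite -ler_pdivlMr// ge_min lexx orbT.
  by lra.
have := @gap_midconvex_pos R r (a + h) (b + h) (c + h) (d + h) r12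
  ltac:(lra) ltac:(lra) ltac:(lra) ltac:(lra).
rewrite /gap.
have hh (x y : R) : (x + h + (y + h)) / 2 = (x + y) / 2 + h by field.
rewrite !hh.
have h0' := ltW h0.
have ua := up a h a0 ltac:(rewrite /s; lra) h0'.
have ub := up b h b0 ltac:(rewrite /s; lra) h0'.
have uc := up c h c0 ltac:(rewrite /s; lra) h0'.
have ud := up d h d0 ltac:(rewrite /s; lra) h0'.
have um := up (((a + c) / 2 + (b + d) / 2) / 2) h ltac:(lra)
  ltac:(rewrite /s; lra) h0'.
have d1 := dn ((a + b) / 2) h ltac:(lra) h0'.
have d2 := dn ((c + d) / 2) h ltac:(lra) h0'.
have d3 := dn ((a + c) / 2) h ltac:(lra) h0'.
have d4 := dn ((b + d) / 2) h ltac:(lra) h0'.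
lra.
Qed.

(** * Averages over the cube and subadditivity of entropy *)

Local Notation cube n := {ffun 'I_n -> bool}.

Definition flip (n : nat) (i : 'I_n) (c : cube n) : cube n :=
  [ffun j => (j == i) (+) c j].

Definition avg (R : realType) (n : nat) (F : cube n -> R) : R :=
  (2 ^+ n)^-1 * \sum_c F c.

Definition condavg (R : realType) (n : nat) (F : cube n -> R)
    (i : 'I_n) : cube n -> R :=
  fun c => (F c + F (flip i c)) / 2.

Lemma flipK (n : nat) (i : 'I_n) : involutive (flip i).
Proof. by move=> c; apply/ffunP => j; rewrite !ffunE addbA addbb. Qed.

Lemma flipC (n : nat) (i j : 'I_n) c : flip i (flip j c) = flip j (flip i c).
Proof. by apply/ffunP => k; rewrite !ffunE addbCA. Qed.

Section cube_average.
Variables (R : realType) (n : nat).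
Implicit Types F G : cube n -> R.

Lemma eq_avg F G : F =1 G -> avg F = avg G.
Proof. by move=> FG; rewrite /avg (eq_bigr _ (fun c _ => FG c)). Qed.

Lemma avg_flip i F : avg (fun c => F (flip i c)) = avg F.
Proof.
rewrite /avg; congr (_ * _).
by rewrite [RHS](reindex_inj (inv_inj (flipK i))).
Qed.

Lemma avgD F G : avg (fun c => F c + G c) = avg F + avg G.
Proof. by rewrite /avg big_split mulrDr. Qed.

Lemma avgZ a F : avg (fun c => a * F c) = a * avg F.
Proof. by rewrite /avg -mulr_sumr mulrCA. Qed.

Lemma avg_cst a : @avg R n (fun=> a) = a.
Proof.
rewrite /avg sumr_const card_ffun card_bool card_ord -[a *+ _]mulr_natr natrX.
by rewrite mulrCA mulVf ?mulr1// expf_neq0// pnatr_eq0.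
Qed.

Lemma avg_sum (I : Type) (s : seq I) (F : I -> cube n -> R) :
  avg (fun c => \sum_(i <- s) F i c) = \sum_(i <- s) avg (F i).
Proof. by rewrite /avg exchange_big mulr_sumr. Qed.

Lemma ler_avg F G : (forall c, F c <= G c) -> avg F <= avg G.
Proof.
move=> FG; rewrite /avg ler_wpM2l ?invr_ge0 ?exprn_ge0//.
by apply: ler_sum => c _.
Qed.

Lemma avg_ge0 F : (forall c, 0 <= F c) -> 0 <= avg F.
Proof. by move=> /ler_avg; rewrite avg_cst. Qed.

Lemma avg_condavg F i : avg (condavg F i) = avg F.
Proof.
rewrite /condavg (@eq_avg _ (fun c => 2^-1 * (F c + F (flip i c)))).
  by rewrite avgZ avgD avg_flip; lra.
by move=> c; rewrite mulrC.
Qed.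

Lemma avg_foldl_condavg F s : avg (foldl (@condavg R n) F s) = avg F.
Proof. by elim: s F => //= i s IH F; rewrite IH avg_condavg. Qed.

(** Averaging over coordinate i makes a function invariant under flips of i, and
    averaging over another coordinate preserves that invariance because flips
    commute. *)
Lemma foldl_condavg_flip i F s : i \in s \/ (forall c, F (flip i c) = F c) ->
  forall c, foldl (@condavg R n) F s (flip i c) = foldl (@condavg R n) F s c.
Proof.
elim: s F => [|j s IH] F; first by case.
move=> H; apply: IH; have [->|ij] := eqVneq i j.
  by right=> c; rewrite /condavg flipK addrC.
case: H => [|H]; first by rewrite inE (negbTE ij) => ?; left.
by right=> c; rewrite /condavg flipC !H.
Qed.

(** Any two points of the cube are joined by flips; induction on the number of
    coordinates where they differ. *)
Lemma flip_invariant_cst F : (forall i c, F (flip i c) = F c) ->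
  forall c c', F c = F c'.
Proof.
move=> H c c'.
elim: {c}_.+1 {-2}c (ltnSn #|[pred i | c i != c' i]|) => // k IH c ck.
have [i iD|cc'] := pickP [pred i | c i != c' i]; last first.
  by congr F; apply/ffunP => i; apply/eqP/negPn/negbT; exact: cc'.
rewrite -(H i); apply: IH; rewrite -ltnS (leq_trans _ ck)// ltnS.
apply: proper_card; apply/properP; split.
  apply/fintype.subsetP => j; rewrite !inE ffunE; have [->|_] := eqVneq j i => //=.
exists i => //; move: iD; rewrite !inE ffunE eqxx.
by case: (c i); case: (c' i).
Qed.

Lemma foldl_condavg_enum F c : foldl (@condavg R n) F (enum 'I_n) c = avg F.
Proof.
rewrite -(avg_foldl_condavg _ (enum 'I_n)) -[LHS]avg_cst; apply: eq_avg => c'.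
apply: flip_invariant_cst => i; apply: foldl_condavg_flip.
by left; rewrite mem_enum.
Qed.

Lemma condavg_ge0 F i : (forall c, 0 <= F c) -> forall c, 0 <= condavg F i c.
Proof. by move=> F0 c; rewrite divr_ge0// addr_ge0. Qed.

(** Jensen's inequality for the jointly convex two-point entropy: averaging over
    one coordinate can only decrease the entropy in another one. *)
Lemma gap_condavg (r : R) F i j : 1 <= r <= 2 -> (forall c, 0 <= F c) ->
  avg (fun c => gap r (condavg F i c) (condavg F i (flip j c)))
    <= avg (fun c => gap r (F c) (F (flip j c))).
Proof.
move=> r12 F0; set G := (fun c => gap r (F c) _).
rewrite -(avg_condavg G i); apply: ler_avg => c.
rewrite /condavg /G flipC ler_pdivlMr// mulrC.
exact: gap_midconvex.
Qed.

Lemma avg_powR_condavg (r : R) F i :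
  avg (fun c => F c `^ r) =
  avg (fun c => gap r (F c) (F (flip i c))) + avg (fun c => condavg F i c `^ r).
Proof.
rewrite -(avg_condavg _ i) -avgD; apply: eq_avg => c.
by rewrite /gap /condavg subrK.
Qed.

(** Average over the coordinates one after the other.  Each step loses exactly
    the one-coordinate entropy of the current function, which [gap_condavg]
    bounds by that of F; the last function is the constant E F. *)
Lemma entropy_tensor (r : R) F : 1 <= r <= 2 -> (forall c, 0 <= F c) ->
  avg (fun c => F c `^ r) <=
    avg F `^ r + \sum_(i < n) avg (fun c => gap r (F c) (F (flip i c))).
Proof.
move=> r12 F0.
have H s G : (forall c, 0 <= G c) -> avg (fun c => G c `^ r) <=
    avg (fun c => foldl (@condavg R n) G s c `^ r) +
      \sum_(i <- s) avg (fun c => gap r (G c) (G (flip i c))).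
  elim: s G => [|i s IH] G G0; first by rewrite big_nil addr0.
  rewrite big_cons (avg_powR_condavg r G i) addrCA lerD2l.
  apply: le_trans (IH _ (condavg_ge0 i G0)) _.
  by rewrite lerD2l ler_sum// => j _; apply: gap_condavg.
have -> : avg F `^ r = avg (fun c => foldl (@condavg R n) F (enum 'I_n) c `^ r).
  rewrite -[LHS]avg_cst; apply: eq_avg => c.
  by rewrite foldl_condavg_enum.
by rewrite -[in X in _ + X]big_enum; exact: H.
Qed.

End cube_average.

(** * The moment recursion *)

Lemma powR_le_root (R : realType) (p x y : R) : 0 < p -> 0 <= x -> 0 <= y ->
  x `^ p <= y -> x <= y `^ p^-1.
Proof.
move=> p0 x0 y0 H.
rewrite -[x]powRr1// -(@mulfV _ p) ?gt_eqF// powRrM.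
by apply: ge0_ler_powR; rewrite ?nnegrE ?powR_ge0 ?invr_ge0 ?(ltW p0).
Qed.

Lemma powRD1 (R : realType) (y s : R) : 0 <= y -> 0 < s ->
  y `^ (s + 1) = y * y `^ s.
Proof.
by move=> y0 s0; rewrite -[in RHS](addrK 1 s) mulr_powRB1// addr_gt0.
Qed.

(** With S = (y^p + z^p)/2 and p = q - 1, the power mean inequality gives
    S^(q/p) = S S^(1/p) >= S (y + z)/2.  What remains of the entropy is
    (y^p - z^p)(y - z)/4, and the tangent inequality at the larger of y and z
    bounds the first factor. *)
Lemma gap_two_point (R : realType) (q y z : R) : 2 <= q -> 0 <= y -> 0 <= z ->
  gap (q / (q - 1)) (y `^ (q - 1)) (z `^ (q - 1)) <=
  (q - 1) / 4 * (y `^ (q - 2) * Num.max (y - z) 0 ^+ 2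
                 + z `^ (q - 2) * Num.max (z - y) 0 ^+ 2).
Proof.
move=> q2 y0 z0; set p := q - 1.
have p1 : 1 <= p by rewrite /p; lra.
have p0 : 0 < p by lra.
have -> : q - 2 = p - 1 by rewrite /p; ring.
have qE : q = p + 1 by rewrite /p subrK.
apply: (@le_trans _ _ (4^-1 * ((y `^ p - z `^ p) * (y - z)))).
  set S := (y `^ p + z `^ p) / 2.
  have S0 : 0 <= S by rewrite divr_ge0// addr_ge0 ?powR_ge0.
  have m0 : 0 <= (y + z) / 2 by rewrite divr_ge0// addr_ge0.
  have SE : S `^ (q / p) = S * S `^ p^-1.
    have -> : q / p = p^-1 + 1 by rewrite qE; field; rewrite gt_eqF.
    by rewrite powRD1// invr_gt0.
  have Sm : (y + z) / 2 <= S `^ p^-1.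
    apply: powR_le_root => //.
    have := powR_midconvex y0 z0 p1; rewrite /S; lra.
  have yq : y `^ p `^ (q / p) = y * y `^ p.
    by rewrite -powRrM mulrCA mulfV ?gt_eqF// mulr1 qE powRD1.
  have zq : z `^ p `^ (q / p) = z * z `^ p.
    by rewrite -powRrM mulrCA mulfV ?gt_eqF// mulr1 qE powRD1.
  rewrite /gap yq zq -/S SE.
  apply: le_trans (lerB (lexx _) (ler_wpM2l S0 Sm)) _.
  by rewrite le_eqVlt; apply/orP; left; apply/eqP; rewrite /S; field.
have [zy|yz] := leP z y.
  have -> : Num.max (z - y) 0 = 0 by apply/max_idPr; lra.
  have -> : Num.max (y - z) 0 = y - z by apply/max_idPl; lra.
  have /(ler_wpM2l (ltac:(lra) : 0 <= y - z)) := powR_tangent y0 z0 p1.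
  rewrite expr0n /=; lra.
have -> : Num.max (z - y) 0 = z - y by apply/max_idPl; lra.
have -> : Num.max (y - z) 0 = 0 by apply/max_idPr; lra.
have /(ler_wpM2l (ltac:(lra) : 0 <= z - y)) := powR_tangent z0 y0 p1.
rewrite expr0n /=; lra.
Qed.

Section moments.
Variables (R : realType) (n : nat).
Implicit Types F G Y Z : cube n -> R.

Lemma avg_eq0 F : (forall c, 0 <= F c) -> avg F = 0 -> forall c, F c = 0.
Proof.
move=> F0 /eqP; rewrite /avg mulf_eq0 invr_eq0 expf_eq0 pnatr_eq0 andbF /=.
by rewrite psumr_eq0// => /allP H c; apply/eqP/H; rewrite mem_index_enum.
Qed.

(** Average the weighted arithmetic-geometric inequality between F / E F and
    G / E G. *)
Lemma avg_hoelder (t : R) F G : 0 <= t <= 1 ->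
  (forall c, 0 <= F c) -> (forall c, 0 <= G c) ->
  avg (fun c => F c `^ t * G c `^ (1 - t)) <= avg F `^ t * avg G `^ (1 - t).
Proof.
move=> t01 F0 G0; have [t0 t1] := andP t01.
have AF := avg_ge0 F0; have AG := avg_ge0 G0.
have [tz|tn0] := eqVneq t 0.
  rewrite tz powRr0 subr0 (powRr1 AG) mul1r; apply: ler_avg => c.
  by rewrite powRr0 powRr1// mul1r.
have [tz|tn1] := eqVneq t 1.
  rewrite tz subrr powRr0 (powRr1 AF) mulr1; apply: ler_avg => c.
  by rewrite powRr0 powRr1// mulr1.
have [Fz|Fn0] := eqVneq (avg F) 0.
  rewrite (@eq_avg _ _ _ (fun=> 0)) ?avg_cst ?mulr_ge0 ?powR_ge0// => c.
  by rewrite (avg_eq0 F0 Fz) powR0// mul0r.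
have [Gz|Gn0] := eqVneq (avg G) 0.
  rewrite (@eq_avg _ _ _ (fun=> 0)) ?avg_cst ?mulr_ge0 ?powR_ge0// => c.
  by rewrite (avg_eq0 G0 Gz) powR0 ?mulr0// subr_eq0 eq_sym.
have PF : 0 < avg F by rewrite lt_neqAle eq_sym Fn0.
have PG : 0 < avg G by rewrite lt_neqAle eq_sym Gn0.
rewrite -[leRHS]mulr1; set B := (X in X * _).
have -> : B * 1 =
    B * avg (fun c => t * ((avg F)^-1 * F c) + (1 - t) * ((avg G)^-1 * G c)).
  by congr (_ * _); rewrite avgD !avgZ !mulVf// !mulr1 subrKC.
rewrite -avgZ /B; apply: ler_avg => c.
have E1 : 0 <= (avg F)^-1 * F c by rewrite mulr_ge0// invr_ge0.
have E2 : 0 <= (avg G)^-1 * G c by rewrite mulr_ge0// invr_ge0.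
apply: le_trans (ler_wpM2l _ (powR_amgm E1 E2 t01)); last first.
  by rewrite mulr_ge0 ?powR_ge0.
rewrite mulrACA; have -> : avg F `^ t * ((avg F)^-1 * F c) `^ t = F c `^ t.
  by rewrite -powRM// mulrA mulfV// mul1r.
by rewrite -powRM// mulrA mulfV// mul1r.
Qed.

(** Lyapunov's inequality between moments. *)
Lemma avg_powR_le (p q : R) Y : 0 < p <= q -> (forall c, 0 <= Y c) ->
  avg (fun c => Y c `^ p) <= avg (fun c => Y c `^ q) `^ (p / q).
Proof.
move=> /andP[p0 pq] Y0; have q0 := lt_le_trans p0 pq.
have t01 : 0 <= p / q <= 1.
  by rewrite ler_pdivrMr// mul1r pq andbT divr_ge0// ltW.
have := @avg_hoelder (p / q) (fun c => Y c `^ q) (fun=> 1) t01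
  (fun c => powR_ge0 _ _) (fun=> ler01).
rewrite avg_cst powR1 mulr1; apply: le_trans; apply: ler_avg => c.
by rewrite /= mulr1 -powRrM mulrCA mulfV ?gt_eqF// mulr1.
Qed.

Lemma avg_powR_logconvex (t a b s : R) Y : 0 <= t <= 1 -> 0 < s ->
  s = t * a + (1 - t) * b -> (forall c, 0 <= Y c) ->
  avg (fun c => Y c `^ s) <=
    avg (fun c => Y c `^ a) `^ t * avg (fun c => Y c `^ b) `^ (1 - t).
Proof.
move=> t01 s0 sE Y0.
apply: le_trans (avg_hoelder t01 (fun c => powR_ge0 _ _) (fun c => powR_ge0 _ _)).
apply: ler_avg => c; rewrite -!powRrM (mulrC a) (mulrC b) -powRD -?sE//.
by rewrite gt_eqF.
Qed.

(** The one-sided variance V_+ = E'[ sum_i ((Z - Z'_i)_+)^2 ], where Z'_i is Z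
    with the i-th sign resampled: resampling flips that sign with probability
    1/2. *)
Definition upvar Z : cube n -> R :=
  fun c => 2^-1 * \sum_(i < n) Num.max (Z c - Z (flip i c)) 0 ^+ 2.

Lemma upvar_ge0 Z c : 0 <= upvar Z c.
Proof. by rewrite mulr_ge0 ?invr_ge0// sumr_ge0// => i _; exact: sqr_ge0. Qed.

(** Entropy subadditivity for Y^(q-1) and the exponent q/(q-1).  In the two-point
    bound the two ends of an edge of the cube play symmetric roles, so the
    average over the cube keeps only the end where Y is larger, twice. *)
Lemma moment_recursion (q : R) Y : 2 <= q -> (forall c, 0 <= Y c) ->
  avg (fun c => Y c `^ q) <=
    avg (fun c => Y c `^ (q - 1)) `^ (q / (q - 1))
    + (q - 1) * avg (fun c => Y c `^ (q - 2) * upvar Y c).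
Proof.
move=> q2 Y0.
have p0 : 0 < q - 1 by lra.
have r12 : 1 <= q / (q - 1) <= 2.
  by rewrite ler_pdivlMr// ler_pdivrMr//; lra.
have := @entropy_tensor R n _ (fun c => Y c `^ (q - 1)) r12 (fun c => powR_ge0 _ _).
rewrite (@eq_avg _ _ _ (fun c => Y c `^ q)); last first.
  by move=> c; rewrite -powRrM mulrCA mulfV ?gt_eqF// mulr1.
move=> /le_trans; apply; rewrite lerD2l.
set D := fun i c => Y c `^ (q - 2) * Num.max (Y c - Y (flip i c)) 0 ^+ 2.
have H i : avg (fun c => gap (q / (q - 1)) (Y c `^ (q - 1)) (Y (flip i c) `^ (q - 1)))
    <= (q - 1) / 2 * avg (D i).
  apply: (@le_trans _ _ (avg (fun c => (q - 1) / 4 * (D i c + D i (flip i c))))).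
    apply: ler_avg => c; rewrite /D flipK; exact: gap_two_point.
  by rewrite avgZ avgD (avg_flip i (D i)); lra.
apply: le_trans (ler_sum _ (fun i _ => H i)) _.
rewrite -mulr_sumr -avg_sum -mulrA -[2^-1 * _]avgZ ler_wpM2l ?(ltW p0)//.
apply: ler_avg => c; rewrite /D /upvar -mulr_sumr mulrCA.
by rewrite lexx.
Qed.

End moments.

(** * Numerical estimates for kappa and K *)

(** The (1,1) Pade approximant of the exponential is an upper bound on [0, 2):
    (2 + z) e^(-z) + z is nondecreasing, since its derivative is
    1 - (1 + z) e^(-z).  It is used both for sqrt e <= 5/3 and for the factors
    of the induction step in the bounded case. *)
Lemma expR_pade (R : realType) (z : R) : 0 <= z < 2 ->
  expR z <= (2 + z) / (2 - z).
Proof.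
move=> /andP[z0 z2]; rewrite ler_pdivlMr ?subr_gt0//.
have [->|zn0] := eqVneq z 0; first by rewrite expR0; lra.
have {zn0} zp : 0 < z by rewrite lt_neqAle eq_sym zn0.
pose h (x : R) := (2 + x) * expR (- x) + x.
have dh (x : R) : is_derive x 1 h (1 - (1 + x) * expR (- x)).
  apply: is_derive_eq.
  by rewrite /GRing.scale /=; ring.
have [|c c0 hE] := @MVT R h (fun x => 1 - (1 + x) * expR (- x)) 0 z zp.
  by apply: derivable_within_continuous => x _; case: (dh x).
have h0 : 0 <= h z - h 0.
  rewrite hE mulr_ge0 ?subr0// subr_ge0 expRN ler_pdivrMr ?expR_gt0// mul1r.
  exact: expR_ge1Dx.
have : 0 <= (h z - h 0) * expR z by rewrite mulr_ge0 ?expR_ge0.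
rewrite /h expRN oppr0 expR0 mulrBl mulrDl -mulrA mulVf ?gt_eqF ?expR_gt0//.
lra.
Qed.

Lemma sqrt_expR1 (R : realType) : Num.sqrt (expR 1) = expR (2^-1) :> R.
Proof.
have -> : expR 1 = expR 2^-1 ^+ 2 :> R by rewrite -expRM_natr mulVf.
by rewrite sqrtr_sqr ger0_norm ?expR_ge0.
Qed.

Lemma sqrt_e_bounds (R : realType) : 3 / 2 <= expR (2^-1 : R) <= 5 / 3.
Proof.
apply/andP; split; first by have := expR_ge1Dx (2^-1 : R); lra.
have -> : 5 / 3 = (2 + 2^-1) / (2 - 2^-1) :> R by field.
by apply: expR_pade; lra.
Qed.

Lemma two_kappaE (R : realType) : 2 * kappa R = (1 - expR (- 2^-1))^-1.
Proof.
have := sqrt_e_bounds R; rewrite /kappa sqrt_expR1 expRN.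
set s := expR _ => H; by field; rewrite !gt_eqF//; lra.
Qed.

Lemma invr_KconstE (R : realType) :
  (Kconst R)^-1 = expR 1 * (1 - expR (- 2^-1)).
Proof.
rewrite /Kconst sqrt_expR1 invrK mulrBr mulr1 -expRD; congr (_ - expR _).
by lra.
Qed.

Lemma Kconst_ge (R : realType) : 9 / 10 <= Kconst R.
Proof.
rewrite /Kconst sqrt_expR1.
have -> : expR 1 = expR 2^-1 ^+ 2 :> R by rewrite -expRM_natr mulVf.
have := sqrt_e_bounds R; set s := expR _ => H.
have p : 0 < s ^+ 2 - s by nra.
rewrite -[leLHS]invrK lef_pV2 ?posrE//; nra.
Qed.

(** From 1 - 1/q <= e^(-1/q). *)
Lemma powR_1subV_le (R : realType) (q : R) : 1 <= q ->
  (1 - q^-1) `^ (q / 2) <= expR (- 2^-1).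
Proof.
move=> q1; have q0 : 0 < q by lra.
have q10 : 0 <= 1 - q^-1 by rewrite subr_ge0 invf_le1.
have -> : - 2^-1 = - q^-1 * (q / 2) by field; rewrite gt_eqF.
rewrite expRM ge0_ler_powR ?nnegrE ?expR_ge0//; first by lra.
exact: expR_ge1Dx.
Qed.

(** The second-order bound 1 - x <= e^(-x - x^2/2) gives an additional factor
    e^(-1/(4q)) <= 4q/(4q+1).  The bounded case needs this room, because
    the bound of [powR_1sub2V_le] exceeds its limit e^(-1). *)
Lemma powR_1subV_le_improved (R : realType) (q : R) : 2 <= q ->
  (1 - q^-1) `^ (q / 2) <= expR (- 2^-1) * ((4 * q) / (4 * q + 1)).
Proof.
move=> q2; have q0 : 0 < q by lra.
set x := q^-1.
have x0 : 0 < x by rewrite invr_gt0.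
have x1 : x <= 1 / 2 by rewrite -[leRHS]invrK lef_pV2 ?posrE//; lra.
pose z := x + x ^+ 2 / 2.
have H : 1 - x <= expR (- z).
  rewrite expRN -[leRHS]mul1r ler_pdivlMr ?expR_gt0//.
  have z02 : 0 <= z < 2 by rewrite /z; nra.
  apply: le_trans (ler_wpM2l _ (expR_pade z02)) _; first lra.
  have z2 : 0 < 2 - z by lra.
  rewrite mulrA ler_pdivrMr// mul1r /z; have := @exprn_ge0 _ 3 x (ltW x0); nra.
have x10 : 0 <= 1 - x by lra.
apply: (@le_trans _ _ (expR (- z) `^ (q / 2))).
  by rewrite ge0_ler_powR ?nnegrE ?expR_ge0//; lra.
rewrite -expRM.
have -> : - z * (q / 2) = - 2^-1 - (x / 4).
  by rewrite /z /x; field; rewrite gt_eqF.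
rewrite expRB ler_wpM2l ?expR_ge0//.
have -> : 4 * q / (4 * q + 1) = (1 + x / 4)^-1.
  by rewrite /x; field; rewrite !gt_eqF//; lra.
by rewrite lef_pV2 ?posrE ?expR_gt0 ?expR_ge1Dx//; lra.
Qed.

(** With y = 1/(q-1), the Pade bound at 2y reads 1 - 2/q <= e^(-2y).  The power
    is then at most e^(-1+y), and the Pade bound at y turns e^y into a rational
    function of q. *)
Lemma powR_1sub2V_le (R : realType) (q : R) : 3 <= q ->
  (1 - q^-1) * (1 - 2 / q) `^ (q / 2 - 1) <=
    expR (- 1) * ((q - 1) * (2 * q - 1) / (q * (2 * q - 3))).
Proof.
move=> q3; have q0 : 0 < q by lra.
pose y := (q - 1)^-1.
have y0 : 0 < y by rewrite invr_gt0; lra.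
have y1 : y <= 1 / 2 by rewrite /y -[leRHS]invrK lef_pV2 ?posrE//; lra.
have e2 : 0 <= q / 2 - 1 by lra.
have a0 : 0 <= 1 - 2 / q by rewrite subr_ge0 ler_pdivrMr//; lra.
have b0 : 0 <= 1 - q^-1 by rewrite subr_ge0 invf_le1//; lra.
have H : 1 - 2 / q <= expR (- (2 * y)).
  have := @expR_pade R (2 * y) ltac:(lra).
  have -> : (2 + 2 * y) / (2 - 2 * y) = (1 - 2 / q)^-1.
    rewrite /y; field; rewrite !gt_eqF//; lra.
  rewrite expRN -{2}[1 - 2 / q]invrK lef_pV2 ?posrE ?invr_gt0 ?expR_gt0//.
  by rewrite subr_gt0 ltr_pdivrMr//; lra.
have H2 : (1 - 2 / q) `^ (q / 2 - 1) <= expR (- 1) * ((2 * q - 1) / (2 * q - 3)).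
  apply: (@le_trans _ _ (expR (- (2 * y)) `^ (q / 2 - 1))).
    by rewrite ge0_ler_powR ?nnegrE ?expR_ge0.
  rewrite -expRM.
  have -> : - (2 * y) * (q / 2 - 1) = - 1 + y.
    by rewrite /y; field; rewrite gt_eqF//; lra.
  rewrite expRD ler_wpM2l ?expR_ge0//.
  have := @expR_pade R y ltac:(lra).
  have -> // : (2 + y) / (2 - y) = (2 * q - 1) / (2 * q - 3).
  by rewrite /y; field; rewrite !gt_eqF//; lra.
apply: le_trans (ler_wpM2l b0 H2) _.
by rewrite le_eqVlt; apply/orP; left; apply/eqP; field; rewrite !gt_eqF//; lra.
Qed.

(** The choice of K makes the sum tend to e^(-1/2) + (1 - e^(-1/2)) = 1 as q
    tends to infinity.  Below, s = e^(-1/2), and what has to be shown is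
    (1 - s)(4q + 1) <= s q (2q - 3); it holds from q = 3 on because
    s >= 6/10. *)
Lemma bounded_step_factor (R : realType) (q : R) : 3 <= q ->
  (1 - q^-1) `^ (q / 2)
    + (Kconst R)^-1 * ((1 - q^-1) * (1 - 2 / q) `^ (q / 2 - 1)) <= 1.
Proof.
move=> q3.
have K0 : 0 <= (Kconst R)^-1 by rewrite invr_ge0; have := Kconst_ge R; lra.
apply: le_trans (lerD (powR_1subV_le_improved _)
  (ler_wpM2l K0 (powR_1sub2V_le q3))) _.
  by lra.
rewrite invr_KconstE mulrACA expRxMexpNx_1 mul1r.
have s6 : 6 / 10 <= expR (- 2^-1 : R) <= 1.
  have := sqrt_e_bounds R; rewrite expRN; set s := expR _ => H.
  have s0 : 0 < s by lra.
  have /andP[h1 h2] := H.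
  rewrite -[s^-1]mul1r ler_pdivlMr// ler_pdivrMr//.
  by apply/andP; split; nra.
set s := expR _ in s6 *.
have -> : (q - 1) * (2 * q - 1) / (q * (2 * q - 3)) = 1 + (q * (2 * q - 3))^-1.
  by field; rewrite !gt_eqF//; lra.
have -> : 4 * q / (4 * q + 1) = 1 - (4 * q + 1)^-1.
  by field; rewrite gt_eqF//; lra.
suff H : (1 - s) * (q * (2 * q - 3))^-1 <= s * (4 * q + 1)^-1.
  move: H; move: (_^-1) (_^-1) => A B; lra.
have p1 : 0 < q * (2 * q - 3) by rewrite mulr_gt0//; lra.
have p2 : 0 < 4 * q + 1 by lra.
rewrite ler_pdivrMr// mulrAC ler_pdivlMr//.
have l1 : (1 - s) * (4 * q + 1) <= 4 / 10 * (4 * q + 1).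
  by rewrite ler_wpM2r//; lra.
have l2 : 6 / 10 * (q * (2 * q - 3)) <= s * (q * (2 * q - 3)).
  by rewrite ler_wpM2r ?(ltW p1)//; lra.
nra.
Qed.

Lemma two_kappa_ge1 (R : realType) : 1 <= 2 * kappa R.
Proof.
rewrite two_kappaE invf_ge1 ?subr_gt0 ?expR_lt1; last by lra.
by rewrite gerBl expR_ge0.
Qed.

(** * Moment bounds for the excess over the mean *)

(** Suppose M > (2 kappa q)^(q/2) N.  Then the first term of the hypothesis is
    less than e^(-1/2) M by [powR_1subV_le], and the second one is at most
    (q-1) M / (2 kappa q) <= (1 - e^(-1/2)) M by the value of kappa: their sum is
    less than M. *)
Lemma moment_step (R : realType) (q M N : R) : 2 <= q -> 0 <= M -> 0 <= N ->
  M <= (2 * kappa R * (q - 1)) `^ (q / 2) * N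
       + (q - 1) * (N `^ (2 / q) * M `^ (1 - 2 / q)) ->
  M <= (2 * kappa R * q) `^ (q / 2) * N.
Proof.
move=> q2 M0 N0 H; rewrite leNgt; apply/negP => MN.
have k1 := two_kappa_ge1 R; have kE := two_kappaE R.
set k := 2 * kappa R in H MN k1 kE.
have q0 : 0 < q by lra.
have kq : 0 < k * q by nra.
set A := (k * q) `^ (q / 2) in MN.
have A0 : 0 < A by rewrite powR_gt0.
have Mp : 0 < M by apply: le_lt_trans MN; rewrite mulr_ge0// ltW.
set s := expR (- 2^-1) in kE.
have s0 : 0 < s by exact: expR_gt0.
have s1 : s < 1 by rewrite expR_lt1; lra.
have T1 : (k * (q - 1)) `^ (q / 2) * N <= s * (A * N).
  have -> : k * (q - 1) = (k * q) * (1 - q^-1) by field; rewrite gt_eqF.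
  rewrite powRM ?(ltW kq)//; last by rewrite subr_ge0 invf_le1//; lra.
  rewrite -/A mulrA ler_wpM2r// mulrC ler_wpM2r ?(ltW A0)//.
  by apply: powR_1subV_le; lra.
have T2 : N `^ (2 / q) * M `^ (1 - 2 / q) <= M / (k * q).
  have E : M = M `^ (2 / q) * M `^ (1 - 2 / q).
    by rewrite -powRD subrKC ?oner_eq0// powRr1.
  rewrite {2}E mulrAC ler_wpM2r ?powR_ge0//.
  have -> : k * q = A `^ (2 / q).
    rewrite /A -powRrM -[LHS]powRr1 ?(ltW kq)//; congr (_ `^ _).
    by field; rewrite gt_eqF.
  rewrite ler_pdivlMr ?powR_gt0// -powRM ?(ltW A0)//.
  apply: powR_le; rewrite ?mulr_ge0 ?invr_ge0 ?(ltW A0) ?(ltW q0)//.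
  by rewrite mulrC ltW.
have T3 : (q - 1) * (M / (k * q)) = (1 - q^-1) * (1 - s) * M.
  have -> : 1 - s = k^-1 by rewrite kE invrK.
  by field; rewrite !gt_eqF//; lra.
have T4 : (q - 1) * (N `^ (2 / q) * M `^ (1 - 2 / q)) <= (1 - s) * M.
  apply: le_trans (ler_wpM2l _ T2) _; first by lra.
  rewrite T3 ler_wpM2r// ler_piMl//; first by lra.
  by rewrite gerBl invr_ge0 ltW.
have T5 : s * (A * N) < s * M by rewrite ltr_pM2l.
lra.
Qed.

Section concentration.
Variables (R : realType) (n : nat) (Z : cube n -> R).
Hypothesis Z0 : forall c, 0 <= Z c.

Definition excess : cube n -> R := fun c => Num.max (Z c - avg Z) 0.

Lemma excess_ge0 c : 0 <= excess c.
Proof. by rewrite /excess le_max lexx orbT. Qed.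

(** The map z -> (z - m)_+ is nondecreasing and 1-Lipschitz. *)
Lemma upvar_excess c : upvar excess c <= upvar Z c.
Proof.
rewrite /upvar ler_wpM2l ?invr_ge0//; apply: ler_sum => i _.
have mx (x : R) : 0 <= Num.max x 0 by rewrite le_max lexx orbT.
rewrite lerXn2r ?nnegrE ?mx//.
rewrite /excess; set a := Z c; set b := Z (flip i c); set m := avg Z.
rewrite ge_max mx andbT.
rewrite lerBlDr ge_max.
have h1 : a - b <= Num.max (a - b) 0 by rewrite le_max lexx.
have h2 : 0 <= Num.max (a - b) 0 by rewrite le_max lexx orbT.
have h3 : b - m <= Num.max (b - m) 0 by rewrite le_max lexx.
have h4 : 0 <= Num.max (b - m) 0 by rewrite le_max lexx orbT.
apply/andP; split; lra.
Qed.

Lemma excess_recursion (q : R) : 2 <= q ->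
  avg (fun c => excess c `^ q) <=
    avg (fun c => excess c `^ (q - 1)) `^ (q / (q - 1))
    + (q - 1) * avg (fun c => excess c `^ (q - 2) * upvar Z c).
Proof.
move=> q2; apply: le_trans (moment_recursion q2 excess_ge0) _.
rewrite lerD2l ler_wpM2l//; first by lra.
by apply: ler_avg => c; rewrite ler_wpM2l ?powR_ge0// upvar_excess.
Qed.

(** The moment recursion with q = 2, applied to Z itself. *)
Lemma efron_stein : avg (fun c => (Z c - avg Z) ^+ 2) <= avg (upvar Z).
Proof.
have := @moment_recursion R n 2 Z (lexx _) Z0.
have -> : 2 - 1 = 1 :> R by lra.
rewrite divr1 subrr mul1r.
rewrite (@eq_avg _ _ (fun c => Z c `^ 1) Z); last by move=> c; rewrite powRr1.
rewrite (@eq_avg _ _ (fun c => _ `^ 0 * _) (upvar Z)); last first.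
  by move=> c; rewrite powRr0 mul1r.
rewrite (@eq_avg _ _ (fun c => Z c `^ 2) (fun c => Z c ^+ 2)); last first.
  by move=> c; rewrite powR_mulrn.
rewrite powR_mulrn ?avg_ge0// => H.
rewrite (@eq_avg _ _ _ (fun c => Z c ^+ 2 + ((- 2 * avg Z) * Z c + avg Z ^+ 2))).
  by rewrite !avgD avgZ avg_cst; lra.
by move=> c; ring.
Qed.

Lemma excess_sqr_avg : avg (fun c => excess c `^ 2) <= avg (upvar Z).
Proof.
apply: le_trans efron_stein; apply: ler_avg => c.
rewrite powR_mulrn ?excess_ge0// /excess.
case: (leP (Z c - avg Z) 0) => h; last by rewrite lexx.
by rewrite expr0n /= sqr_ge0.
Qed.

(** Since Z - E Z has mean zero, E|Z - E Z| = 2 E Y; the factor 2 is what makes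
    the constant K available for small exponents. *)
Lemma excess_avg_sqr : (2 * avg excess) ^+ 2 <= avg (upvar Z).
Proof.
apply: le_trans efron_stein.
pose u c := `|Z c - avg Z|.
have -> : 2 * avg excess = avg u.
  rewrite -avgZ (@eq_avg _ _ _ (fun c => u c + (Z c + - avg Z))).
    by rewrite !avgD avg_cst subrr addr0.
  move=> c; rewrite /u /excess; case: (leP (Z c - avg Z) 0) => h.
    by rewrite ler0_norm// mulr0 addNr.
  by rewrite gtr0_norm//; lra.
have : 0 <= avg (fun c => (u c - avg u) ^+ 2).
  by apply: avg_ge0 => c; exact: sqr_ge0.
rewrite (@eq_avg _ _ _
  (fun c => (Z c - avg Z) ^+ 2 + ((- 2 * avg u) * u c + avg u ^+ 2))).
  by rewrite !avgD avgZ avg_cst; lra.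
by move=> c; rewrite -[in RHS]real_normK ?num_real// -/(u c); ring.
Qed.

(** The exponent s of the moment is kept apart from the exponent q/2 of V: the
    induction hypothesis at s - 1 is used with the V-moment of order s/2.  For
    s <= 2 the bound is the Efron-Stein inequality. *)
Lemma excess_moment_upvar (k : nat) (s q : R) :
  1 <= s <= k%:R + 2 -> 2 <= q -> s <= q ->
  avg (fun c => excess c `^ s) <=
    (2 * kappa R * s) `^ (s / 2) * avg (fun c => upvar Z c `^ (q / 2)) `^ (s / q).
Proof.
have k1 := two_kappa_ge1 R.
elim: k s q => [|k IH] s q /andP[s1 sk] q2 sq.
  have s0 : 0 < s by lra.
  apply: (@le_trans _ _ (avg (upvar Z) `^ (s / 2))).
    apply: le_trans (avg_powR_le (q := 2) _ excess_ge0) _; first by lra.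
    apply: powR_le; [lra| |exact: excess_sqr_avg].
    by apply: avg_ge0 => c; exact: powR_ge0.
  apply: (@le_trans _ _ (avg (fun c => upvar Z c `^ (q / 2)) `^ (s / q))).
    have -> : s / q = (1 / (q / 2)) * (s / 2) by field; rewrite gt_eqF//; lra.
    rewrite [leRHS]powRrM; apply: powR_le.
    - lra.
    - by apply: avg_ge0; exact: upvar_ge0.
    have := @avg_powR_le R n 1 (q / 2) (upvar Z) ltac:(lra) (upvar_ge0 Z).
    by rewrite (@eq_avg _ _ _ (upvar Z))// => c; rewrite powRr1// upvar_ge0.
  rewrite ler_peMl ?powR_ge0//.
  rewrite -[leLHS](powRr0 (2 * kappa R * s)) ler_powR//; last by lra.
  by nra.
have [sk'|sk'] := leP s (k%:R + 2); first by apply: IH => //; rewrite s1.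
have k0 : 0 <= k%:R :> R by [].
have s2 : 2 <= s by lra.
have s0 : 0 < s by lra.
set N := avg (fun c => upvar Z c `^ (s / 2)).
have N0 : 0 <= N by apply: avg_ge0 => c; exact: powR_ge0.
set M := avg (fun c => excess c `^ s).
have M0 : 0 <= M by apply: avg_ge0 => c; exact: powR_ge0.
(* The case q = s; larger q follow from Lyapunov's inequality for V. *)
have MN : M <= (2 * kappa R * s) `^ (s / 2) * N.
  apply: moment_step => //; apply: le_trans (excess_recursion s2) _.
  apply: lerD.
    have H : avg (fun c => excess c `^ (s - 1)) <=
        (2 * kappa R * (s - 1)) `^ ((s - 1) / 2) * N `^ ((s - 1) / s).
      by apply: IH => //; rewrite -natr1 in sk; lra.
    apply: (@le_trans _ _ (((2 * kappa R * (s - 1)) `^ ((s - 1) / 2)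
                            * N `^ ((s - 1) / s)) `^ (s / (s - 1)))).
      apply: powR_le => //; first by rewrite divr_ge0//; lra.
      by apply: avg_ge0 => c; exact: powR_ge0.
    rewrite powRM ?powR_ge0// -!powRrM.
    have -> : (s - 1) / 2 * (s / (s - 1)) = s / 2 by field; rewrite gt_eqF//; lra.
    have -> : (s - 1) / s * (s / (s - 1)) = 1.
      by field; rewrite !gt_eqF//; lra.
    by rewrite powRr1.
  rewrite ler_wpM2l//; first by lra.
  have t01 : 0 <= 2 / s <= 1.
    by rewrite ler_pdivrMr// mul1r s2 andbT divr_ge0// ltW.
  apply: le_trans (avg_hoelder t01 (fun c => powR_ge0 _ _) (fun c => powR_ge0 _ _)).
  apply: ler_avg => c; rewrite -!powRrM.
  have -> : s / 2 * (2 / s) = 1 by field; rewrite gt_eqF.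
  have -> : s * (1 - 2 / s) = s - 2 by field; rewrite gt_eqF.
  by rewrite powRr1 ?upvar_ge0// mulrC.
apply: le_trans MN _; rewrite ler_wpM2l ?powR_ge0//.
have -> : s / q = (s / 2) / (q / 2) by field; rewrite gt_eqF//; lra.
by apply: avg_powR_le; [lra|exact: upvar_ge0].
Qed.

End concentration.

(** Only K >= 9/10 matters here.  The power is compared with x = 9s/10 when
    s >= 2 or x <= 1, and with sqrt x in the remaining range. *)
Lemma bounded_base (R : realType) (s : R) : 1 <= s <= 3 ->
  (3 * s - 1) / 4 <= (Kconst R * s) `^ (s / 2).
Proof.
move=> /andP[s1 s3]; have K9 := Kconst_ge R.
have s0 : 0 <= s by lra.
apply: (@le_trans _ _ ((9 / 10 * s) `^ (s / 2))); last first.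
  by apply: powR_le; [lra|lra|rewrite ler_wpM2r].
set x := 9 / 10 * s.
have x0 : 0 < x by rewrite /x; lra.
have [s2|s2] := leP 2 s.
  by apply: (@le_trans _ _ x); [rewrite /x; lra|apply: le1r_powR; rewrite /x; lra].
have [x1|x1] := leP x 1.
  apply: (@le_trans _ _ x); first by rewrite /x; lra.
  by apply: ger1_powR; [rewrite x0|lra].
apply: (@le_trans _ _ (x `^ 2^-1)); last by apply: ler_powR; lra.
rewrite powR12_sqrt ?(ltW x0)// -[leLHS]ger0_norm; last by lra.
by rewrite -sqrtr_sqr ler_wsqrtr// /x; nra.
Qed.

(** After division by X^(q/2) with X = K q c, this is
    [bounded_step_factor]. *)
Lemma bounded_step (R : realType) (q c : R) : 3 <= q -> 0 <= c ->
  (Kconst R * (q - 1) * c) `^ (q / 2)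
    + (q - 1) * (c * (Kconst R * (q - 2) * c) `^ (q / 2 - 1))
  <= (Kconst R * q * c) `^ (q / 2).
Proof.
move=> q3 c0; have := bounded_step_factor q3; have := Kconst_ge R.
set K := Kconst R => K9 H.
have q0 : 0 < q by lra.
set X := K * q * c.
have XE : X = K * q * c by [].
clearbody X.
have X0 : 0 <= X by rewrite XE !mulr_ge0//; lra.
have -> : K * (q - 1) * c = X * (1 - q^-1) by rewrite XE; field; rewrite gt_eqF.
have -> : K * (q - 2) * c = X * (1 - 2 / q) by rewrite XE; field; rewrite gt_eqF.
have b0 : 0 <= 1 - q^-1 by rewrite subr_ge0 invf_le1//; lra.
have a0 : 0 <= 1 - 2 / q by rewrite subr_ge0 ler_pdivrMr//; lra.
rewrite !powRM//.
have -> : X `^ (q / 2) * (1 - q^-1) `^ (q / 2)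
    + (q - 1) * (c * (X `^ (q / 2 - 1) * (1 - 2 / q) `^ (q / 2 - 1)))
  = X `^ (q / 2) * ((1 - q^-1) `^ (q / 2)
     + K^-1 * ((1 - q^-1) * (1 - 2 / q) `^ (q / 2 - 1))).
  rewrite -(@mulr_powRB1 _ X (q / 2)) ?divr_gt0//.
  set A := X `^ _; set B := (1 - q^-1) `^ _; set C := (1 - 2 / q) `^ _.
  have -> : c = X / (K * q) by rewrite XE; field; rewrite !gt_eqF//; lra.
  by field; rewrite !gt_eqF//; lra.
by rewrite ler_piMr// powR_ge0.
Qed.

Section bounded.
Variables (R : realType) (n : nat) (Z : cube n -> R).
Hypothesis Z0 : forall c, 0 <= Z c.
Variable C : R.
Hypothesis VC : forall c, upvar Z c <= C.

Let C0 : 0 <= C.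
Proof.
pose c0 : cube n := [ffun=> true].
exact: le_trans (upvar_ge0 Z c0) (VC c0).
Qed.

Let avgVC : avg (upvar Z) <= C.
Proof. by rewrite -[leRHS](@avg_cst R n); apply: ler_avg. Qed.

Let excess_recursion_bounded (q : R) : 2 <= q ->
  avg (fun c => excess Z c `^ q) <=
    avg (fun c => excess Z c `^ (q - 1)) `^ (q / (q - 1))
    + (q - 1) * (C * avg (fun c => excess Z c `^ (q - 2))).
Proof.
move=> q2; apply: le_trans (excess_recursion Z q2) _.
rewrite lerD2l ler_wpM2l//; first by lra.
rewrite -avgZ; apply: ler_avg => c.
by rewrite mulrC ler_wpM2r ?powR_ge0.
Qed.

Let excess1 : avg (fun c => excess Z c `^ 1) <= 2^-1 * C `^ 2^-1.
Proof.
rewrite (@eq_avg _ _ _ (excess Z)); last first.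
  by move=> c; rewrite powRr1// excess_ge0.
have H := le_trans (excess_avg_sqr Z0) avgVC.
have A0 : 0 <= 2 * avg (excess Z).
  by rewrite mulr_ge0// avg_ge0//; exact: excess_ge0.
have := ler_wsqrtr H; rewrite sqrtr_sqr ger0_norm// -powR12_sqrt//; lra.
Qed.

Let excess2 : avg (fun c => excess Z c `^ 2) <= C.
Proof. exact: le_trans (excess_sqr_avg Z0) avgVC. Qed.

(** The moment recursion at q = 3, with the first two moments just bounded. *)
Let excess3 : avg (fun c => excess Z c `^ 3) <= 2 * C `^ (3 / 2).
Proof.
apply: le_trans (excess_recursion_bounded _) _; first by lra.
have -> : 3 - 1 = 2 :> R by lra.
have -> : 3 - 2 = 1 :> R by lra.
have h : avg (fun c => excess Z c `^ 2) `^ (3 / 2) <= C `^ (3 / 2).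
  by apply: powR_le; [lra|apply: avg_ge0 => c; exact: powR_ge0|exact: excess2].
have := ler_wpM2l C0 excess1; move: h.
have -> : C `^ (3 / 2) = C * C `^ 2^-1.
  have -> : 3 / 2 = 2^-1 + 1 :> R by lra.
  by rewrite powRD1.
lra.
Qed.

(** The induction starts on the interval [1, 3], where the bound follows from
    log-convexity of the moments between the exponents 1 and 3.  The constants
    1/2 and 2 of these two moments combine to 2^(s-2), which is at most
    t/2 + 2(1-t) = (3s-1)/4. *)
Let excess_base (s : R) : 1 <= s <= 3 ->
  avg (fun c => excess Z c `^ s) <= (Kconst R * s * C) `^ (s / 2).
Proof.
move=> s13; have [s1 s3] := andP s13.
pose t := (3 - s) / 2.
have t01 : 0 <= t <= 1 by rewrite /t; apply/andP; split; lra.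
have [t0 t1] := andP t01.
have K9 := Kconst_ge R.
have sE : s = t * 1 + (1 - t) * 3 by rewrite /t; field.
apply: le_trans (avg_powR_logconvex t01 _ sE (excess_ge0 Z)) _; first by lra.
apply: (@le_trans _ _ ((2^-1 * C `^ 2^-1) `^ t * (2 * C `^ (3 / 2)) `^ (1 - t))).
  apply: ler_pM; rewrite ?powR_ge0//.
    by apply: powR_le => //; apply: avg_ge0 => c; exact: powR_ge0.
  by apply: powR_le => //; [lra|apply: avg_ge0 => c; exact: powR_ge0].
have K0 : 0 <= Kconst R * s by rewrite mulr_ge0//; lra.
rewrite [leRHS]powRM//; have := bounded_base s13.
move: ((Kconst R * s) `^ (s / 2)) => B BH.
rewrite !powRM ?powR_ge0 ?invr_ge0//.
rewrite mulrACA -!powRrM -powRD; last by apply/implyP => /eqP; lra.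
have -> : 2^-1 * t + 3 / 2 * (1 - t) = s / 2 by rewrite /t; field.
rewrite ler_wpM2r ?powR_ge0//.
apply: le_trans _ BH.
have := @powR_amgm R 2^-1 2 t _ _ t01.
rewrite /t; lra.
Qed.

Lemma excess_moment_bounded_nat (k : nat) (s : R) : 1 <= s <= k%:R + 3 ->
  avg (fun c => excess Z c `^ s) <= (Kconst R * s * C) `^ (s / 2).
Proof.
elim: k s => [|k IH] s /andP[s1 sk].
  by apply: excess_base; rewrite s1 /=; lra.
have [sk'|sk'] := leP s (k%:R + 3); first by apply: IH; rewrite s1.
have k0 : 0 <= k%:R :> R by [].
have K9 := Kconst_ge R.
have s3 : 3 <= s by lra.
apply: le_trans _ (bounded_step s3 C0).
apply: le_trans (excess_recursion_bounded _) _; first by lra.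
rewrite -natr1 in sk; apply: lerD.
  have -> : s / 2 = (s - 1) / 2 * (s / (s - 1)) by field; rewrite gt_eqF//; lra.
  rewrite [leRHS]powRrM; apply: powR_le.
  - by rewrite divr_ge0//; lra.
  - by apply: avg_ge0 => c; exact: powR_ge0.
  - by apply: IH; apply/andP; split; lra.
rewrite ler_wpM2l ?ler_wpM2l//; first by lra.
have -> : s / 2 - 1 = (s - 2) / 2 by field.
by apply: IH; apply/andP; split; lra.
Qed.

Lemma excess_moment_bounded (q : R) : 1 <= q ->
  avg (fun c => excess Z c `^ q) <= (Kconst R * q * C) `^ (q / 2).
Proof.
move=> q1; apply: (@excess_moment_bounded_nat (Num.truncn q)); rewrite q1 /=.
by have := truncnS_gt q; rewrite -natr1; lra.
Qed.

End bounded.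

(** * The forms that define W_k *)

Definition signs (R : realType) (n : nat) (c : cube n) : 'I_n -> R :=
  fun i => (-1) ^+ c i.

Lemma compact_coefs_bounded (R : realType) (n d : nat) (TT : set (coefs R n d)) :
  compact TT -> exists M : R, 0 <= M /\ forall t, TT t -> forall I, `|t I| <= M.
Proof.
move=> cT.
have H (I : msubset n d) : exists M : R, forall t, TT t -> `|t I| <= M.
  have cI : compact ((fun t : coefs R n d => t I) @` TT).
    apply: continuous_compact => //; apply: continuous_subspaceT.
    exact: proj_continuous.
  have [M [_ MP]] := compact_bounded cI.
  exists (M + 1) => t tT; apply: (MP (M + 1)); first by rewrite ltrDl.
  by exists t.
have [M MP] := choice H.
exists (\sum_I `|M I|); split; first by apply: sumr_ge0.
move=> t tT I; apply: le_trans (MP I t tT) _; apply: le_trans (ler_norm _) _.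
by rewrite (bigD1 I)//= lerDl sumr_ge0.
Qed.

Definition unit_tuples (R : realType) (n k : nat) : set ('I_k -> 'rV[R]_n) :=
  [set a | forall h, norm2 (a h) <= 1].

(** The coefficient of the monomial indexed by J in the form whose absolute value
    is maximized in W_k. *)
Definition chaos_weight (R : realType) (n d k : nat) (t : coefs R n d)
    (alpha : 'I_k -> 'rV[R]_n) (J : {set 'I_n}) : R :=
  \sum_(i : {ffun 'I_k -> 'I_n} | #|[set i h | h : 'I_k] :|: J| == d)
     (\prod_(h < k) alpha h ord0 (i h)) * coef t ([set i h | h : 'I_k] :|: J).

Definition chaos_form (R : realType) (n d k : nat) (x : 'I_n -> R)
    (t : coefs R n d) (alpha : 'I_k -> 'rV[R]_n) : R :=
  \sum_(J : {set 'I_n} | #|J| == (d - k)%N)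
     (\prod_(j in J) x j) * chaos_weight t alpha J.

Lemma big_msubset (R : realType) (n m : nat) (F : {set 'I_n} -> R) :
  \sum_(J : msubset n m) F (val J) = \sum_(J : {set 'I_n} | #|J| == m) F J.
Proof. by rewrite (@big_sub _ _ _ _ [pred J : {set 'I_n} | #|J| == m]). Qed.

Lemma chaosWE (R : realType) (n d k : nat) (TT : set (coefs R n d))
    (x : 'I_n -> R) :
  chaosW TT k x = sup [set sup [set `|chaos_form x t alpha| | alpha in
    @unit_tuples R n k] | t in TT].
Proof.
rewrite /chaosW; congr sup; apply/seteqP; split=> y [t tT <-]; exists t => //;
  congr sup; apply/seteqP; split=> z [a aA <-]; exists a => //; congr `|_|;
  by rewrite /chaos_form -big_msubset.
Qed.

Lemma norm2_ge (R : realType) (n : nat) (a : 'rV[R]_n) i : `|a ord0 i| <= norm2 a.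
Proof.
rewrite -sqrtr_sqr /norm2 ler_wsqrtr// (bigD1 i)//= lerDl sumr_ge0// => j _.
exact: sqr_ge0.
Qed.

Lemma norm2_zero (R : realType) (n : nat) : norm2 (0 : 'rV[R]_n) = 0.
Proof. by rewrite /norm2 big1 ?sqrtr0// => i _; rewrite mxE expr0n. Qed.

Lemma chaos_form_bounded (R : realType) (n d k : nat) (TT : set (coefs R n d)) :
  compact TT -> exists B : R, forall (c : cube n) t alpha, TT t ->
    unit_tuples alpha -> `|chaos_form (signs R c) t (alpha : 'I_k -> _)| <= B.
Proof.
move=> /compact_coefs_bounded [M [M0 MP]].
exists (\sum_(J : {set 'I_n} | #|J| == (d - k)%N)
   \sum_(i : {ffun 'I_k -> 'I_n} | #|[set i h | h : 'I_k] :|: J| == d) M).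
move=> c t alpha tT aA; apply: le_trans (ler_norm_sum _ _ _) _.
apply: ler_sum => J _; rewrite normrM normr_prod big1 ?mul1r; last first.
  by move=> j _; rewrite normrX normrN1 expr1n.
apply: le_trans (ler_norm_sum _ _ _) _; apply: ler_sum => i _.
rewrite normrM -[leRHS]mul1r ler_pM//.
  rewrite normr_prod; apply: prodr_ile1 => h _; rewrite normr_ge0 /=.
  exact: le_trans (norm2_ge _ _) (aA h).
by rewrite /coef; case: insub => //= [I|]; [exact: MP|rewrite normr0].
Qed.

Section chaosW_sup.
Variables (R : realType) (n d k : nat) (TT : set (coefs R n d)).
Hypotheses (T0 : TT !=set0) (cT : compact TT).
Implicit Types (c : cube n) (alpha : 'I_k -> 'rV[R]_n).

Let inner c (t : coefs R n d) :=
  [set `|@chaos_form R n d k (signs R c) t alpha| | alpha in @unit_tuples R n k].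

Let has_sup_inner c t : TT t -> has_sup (inner c t).
Proof.
move=> tT; split.
  exists `|chaos_form (signs R c) t (fun _ : 'I_k => 0)|; exists (fun=> 0) => //.
  by move=> h; rewrite norm2_zero.
have [B BP] := chaos_form_bounded k cT.
by exists B => _ [alpha aA <-]; exact: BP.
Qed.

Let has_sup_outer c : has_sup [set sup (inner c t) | t in TT].
Proof.
have [t0 t0T] := T0; split; first by exists (sup (inner c t0)); exists t0.
have [B BP] := chaos_form_bounded k cT.
exists B => _ [t tT <-]; apply: ge_sup; first by case: (has_sup_inner c tT).
by move=> _ [alpha aA <-]; exact: BP.
Qed.

(** These two lemmas characterize W_k on the cube by its forms; both need the
    suprema to be finite, which comes from compactness. *)
Lemma chaosW_ge c t alpha : TT t -> unit_tuples alpha ->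
  `|chaos_form (signs R c) t alpha| <= chaosW TT k (signs R c).
Proof.
move=> tT aA; rewrite chaosWE.
apply: (@le_trans _ _ (sup (inner c t))).
  by apply: sup_upper_bound; [exact: has_sup_inner|exists alpha].
by apply: sup_upper_bound; [exact: has_sup_outer|exists t].
Qed.

Lemma chaosW_approx c (e : R) : 0 < e -> exists t, TT t /\ exists alpha,
  unit_tuples alpha /\
  chaosW TT k (signs R c) - e < `|chaos_form (signs R c) t alpha|.
Proof.
move=> e0; rewrite chaosWE.
have e2 : 0 < e / 2 by rewrite divr_gt0.
have [_ [t tT <-] h1] := sup_adherent e2 (has_sup_outer c).
have [_ [alpha aA <-] h2] := sup_adherent e2 (has_sup_inner c tT).
by exists t; split => //; exists alpha; split => //; lra.
Qed.

End chaosW_sup.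

Lemma sup_nonneg (R : realType) (S : set R) :
  (forall x, S x -> 0 <= x) -> 0 <= sup S.
Proof.
move=> S0; have [hS|/sup_out ->//] := pselect (has_sup S).
by have [[x Sx] _] := hS; rewrite (le_trans (S0 x Sx))// sup_upper_bound.
Qed.

Lemma chaosW_ge0 (R : realType) (n d k : nat) (TT : set (coefs R n d)) x :
  0 <= chaosW TT k x.
Proof.
by apply: sup_nonneg => _ [t _ <-]; apply: sup_nonneg => _ [a _ <-].
Qed.

Lemma coef_val (R : realType) (n d : nat) (t : coefs R n d) (I : msubset n d) :
  coef t (val I) = t I.
Proof. by rewrite /coef valK. Qed.

(** For k = 0 there is a single tuple of indices, the empty one, so the forms do
    not depend on the unit vectors and the inner supremum is over one point. *)
Lemma chaosZ_W0 (R : realType) (n d : nat) (TT : set (coefs R n d)) x :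
  chaosZ TT x = chaosW TT 0 x.
Proof.
rewrite chaosWE /chaosZ; congr sup; apply: eq_imagel => t _.
have E alpha : @chaos_form R n d 0 x t alpha =
    \sum_(I : msubset n d) (\prod_(i in val I) x i) * t I.
  rewrite /chaos_form subn0 -big_msubset; apply: eq_bigr => I _; congr (_ * _).
  rewrite /chaos_weight.
  have im0 (i : {ffun 'I_0 -> 'I_n}) : [set i h | h : 'I_0]%SET = finset.set0.
    by apply/setP => j; rewrite inE; apply/imsetP => -[[]].
  rewrite (big_pred1 [ffun h : 'I_0 => widen_ord (leq0n n) h]).
    by rewrite big_ord0 mul1r im0 finset.set0U coef_val.
  move=> i; rewrite im0 finset.set0U (valP I); apply/esym/eqP/ffunP => -[//].
rewrite -[LHS]sup1; congr sup; apply/seteqP; split=> [_ ->|_ [a _ <-]].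
  by exists (fun=> 0) => [[]//|]; rewrite E.
by rewrite E.
Qed.

(** For k = d only J = set0 contributes, and its monomial is 1. *)
Lemma chaosW_top (R : realType) (n d : nat) (TT : set (coefs R n d)) x y :
  chaosW TT d x = chaosW TT d y.
Proof.
rewrite !chaosWE; congr sup; apply: eq_imagel => t _; congr sup.
apply: eq_imagel => a _; congr `|_|; rewrite /chaos_form subnn.
apply: eq_bigr => J; rewrite cards_eq0 => /eqP ->.
by rewrite !big_set0.
Qed.

Section flip.
Variables (R : realType) (n d k : nat) (t : coefs R n d).
Hypothesis kd : (k < d)%N.
Implicit Types (x : 'I_n -> R) (J : {set 'I_n}).

Definition cons_tuple (beta : 'rV[R]_n) (alpha : 'I_k -> 'rV[R]_n) :
    'I_k.+1 -> 'rV[R]_n :=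
  fun h => oapp alpha beta (unlift ord0 h).

(** Flipping x_i changes the form by 2 x_i times the i-th entry of this vector
    ([chaos_form_flip]), and pairing this vector with one more unit vector gives
    a form of order k + 1 ([chaos_form_cons]). *)
Definition chaos_grad x (alpha : 'I_k -> 'rV[R]_n) (i : 'I_n) : R :=
  \sum_(J : {set 'I_n} | #|J| == (d - k.+1)%N)
     (\prod_(j in J) x j) * chaos_weight t alpha (i |: J).

(** The k indices cannot complete J to a set of size d. *)
Lemma chaos_weight_small (alpha : 'I_k -> 'rV[R]_n) J :
  (#|J| < d - k)%N -> chaos_weight t alpha J = 0.
Proof.
move=> Jk; apply: big1 => i /eqP iJ; exfalso.
suff : (d <= k + #|J|)%N by move: Jk kd; lia.
rewrite -{1}iJ; apply: leq_trans (leq_card_setU _ _).1 _; rewrite leq_add2r.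
by apply: leq_trans (leq_imset_card _ _) _; rewrite card_ord.
Qed.

(** A tuple of k+1 indices is an index i followed by a tuple of k indices, and
    the set of all of them together with J is the set of the last k together
    with i |: J. *)
Lemma chaos_weight_cons beta (alpha : 'I_k -> 'rV[R]_n) J :
  chaos_weight t (cons_tuple beta alpha) J =
  \sum_i beta ord0 i * chaos_weight t alpha (i |: J).
Proof.
pose f (p : 'I_n * {ffun 'I_k -> 'I_n}) : {ffun 'I_k.+1 -> 'I_n} :=
  [ffun h => oapp p.2 p.1 (unlift ord0 h)].
pose g (i : {ffun 'I_k.+1 -> 'I_n}) : 'I_n * {ffun 'I_k -> 'I_n} :=
  (i ord0, [ffun h => i (lift ord0 h)]).
have fK : cancel f g.
  move=> [i j]; rewrite /f /g !ffunE unlift_none /=; congr pair.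
  by apply/ffunP => h; rewrite !ffunE liftK.
have gK : cancel g f.
  move=> i; apply/ffunP => h; rewrite ffunE /g /=.
  by case: unliftP => [j ->|->] /=; rewrite ?ffunE.
have im p J' : ([set f p h | h : 'I_k.+1] :|: J' =
    [set p.2 h | h : 'I_k] :|: (p.1 |: J'))%SET.
  apply/setP => y; rewrite !inE [in RHS]orbCA orbA; congr orb.
  apply/imsetP/orP => [[h _ ->]|].
    rewrite /f ffunE; case: unliftP => [j _|_] /=; last by left.
    by right; apply: imset_f.
  move=> [/eqP ->|/imsetP[h _ ->]].
    by exists ord0 => //; rewrite /f ffunE unlift_none.
  by exists (lift ord0 h) => //; rewrite /f ffunE liftK.
rewrite /chaos_weight (reindex f) /=; last first.
  by exists g => i _; [exact: fK|exact: gK].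
under eq_bigl do rewrite im.
rewrite (eq_bigr (fun p : 'I_n * {ffun 'I_k -> 'I_n} =>
    beta ord0 p.1 * ((\prod_(h < k) alpha h ord0 (p.2 h)) *
    coef t ([set p.2 h | h : 'I_k] :|: (p.1 |: J))%SET))); last first.
  move=> p _; rewrite im mulrA; congr (_ * _); rewrite big_ord_recl.
  rewrite /cons_tuple /f ffunE unlift_none /=; congr (_ * _).
  by apply: eq_bigr => h _; rewrite ffunE liftK.
rewrite -(pair_big_dep xpredT (fun i (j : {ffun 'I_k -> 'I_n}) =>
   #|[set j h | h : 'I_k] :|: (i |: J)| == d)
   (fun i (j : {ffun 'I_k -> 'I_n}) =>
     beta ord0 i * ((\prod_(h < k) alpha h ord0 (j h)) *
     coef t ([set j h | h : 'I_k] :|: (i |: J))%SET))) /=.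
by apply: eq_bigr => i _; rewrite mulr_sumr.
Qed.

Lemma chaos_form_cons x beta (alpha : 'I_k -> 'rV[R]_n) :
  chaos_form x t (cons_tuple beta alpha) =
  \sum_i beta ord0 i * chaos_grad x alpha i.
Proof.
rewrite /chaos_form; under eq_bigr do rewrite chaos_weight_cons mulr_sumr.
rewrite exchange_big; apply: eq_bigr => i _; rewrite mulr_sumr.
by apply: eq_bigr => J _; rewrite mulrCA.
Qed.

Lemma cons_tuple_unit beta (alpha : 'I_k -> 'rV[R]_n) :
  norm2 beta <= 1 -> unit_tuples alpha -> unit_tuples (cons_tuple beta alpha).
Proof. by move=> b1 aA h; rewrite /cons_tuple; case: unlift. Qed.

Lemma signs_flip (c : cube n) i j :
  signs R (flip i c) j = (-1) ^+ (j == i) * signs R c j.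
Proof. by rewrite /signs ffunE -signr_addb. Qed.

Lemma prod_signs_flip (c : cube n) i J :
  \prod_(j in J) signs R (flip i c) j =
  (-1) ^+ (i \in J) * \prod_(j in J) signs R c j.
Proof.
under eq_bigr do rewrite signs_flip.
rewrite big_split /=; congr (_ * _); have [iJ|iJ] := boolP (i \in J).
  rewrite (bigD1 i)//= eqxx big1 ?mulr1// => j /andP[_ /negbTE ->].
  by rewrite expr0.
rewrite big1// => j jJ; have [ji|] := eqVneq j i; last by rewrite expr0.
by rewrite -ji jJ in iJ.
Qed.

(** Only the monomials with i in J change, and they change sign.  Writing
    J = i |: J' gives the sets J' of the gradient that do not contain i; the
    other ones contribute 0 by [chaos_weight_small]. *)
Lemma chaos_form_flip (c : cube n) i (alpha : 'I_k -> 'rV[R]_n) :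
  chaos_form (signs R c) t alpha - chaos_form (signs R (flip i c)) t alpha =
  2 * (signs R c i * chaos_grad (signs R c) alpha i).
Proof.
rewrite /chaos_form -sumrB (bigID (fun J : {set 'I_n} => i \in J)) /= addrC.
rewrite big1 ?add0r; last first.
  by move=> J /andP[_ /negbTE iJ]; rewrite prod_signs_flip iJ mul1r subrr.
rewrite (reindex_onto (fun J => i |: J)%SET (fun J => J :\ i)%SET) /=; last first.
  by move=> J /andP[_ iJ]; rewrite finset.setD1K.
rewrite /chaos_grad mulrA mulr_sumr.
rewrite [RHS](bigID (fun J : {set 'I_n} => i \in J)) /= [RHS]addrC.
rewrite [X in _ = _ + X]big1 ?addr0; last first.
  move=> J /andP[/eqP Jd iJ].
  have -> : (i |: J = J)%SET by apply/finset.setUidPr; rewrite finset.sub1set.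
  by rewrite chaos_weight_small ?mulr0// Jd; move: kd; lia.
apply: eq_big => J.
  rewrite finset.setU11 andbT; have [iJ|iJ] := boolP (i \in J).
    rewrite andbF; apply/negP => /andP[_ /eqP JE].
    by move: iJ; rewrite -JE !inE eqxx.
  rewrite finset.setU1K// eqxx !andbT cardsU1 iJ add1n.
  have -> : (d - k = (d - k.+1).+1)%N by move: kd; lia.
  by rewrite eqSS.
move=> /andP[_ /eqP JE].
have iJ : i \notin J by rewrite -JE !inE eqxx.
rewrite prod_signs_flip finset.setU11 finset.big_setU1//=; ring.
Qed.

End flip.

(** * The chaos is self-bounding *)

Section self_bounding.
Variables (R : realType) (n d k : nat) (TT : set (coefs R n d)).
Hypotheses (T0 : TT !=set0) (cT : compact TT) (kd : (k < d)%N).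

(** Use the normalized gradient as the additional unit vector. *)
Lemma chaos_grad_norm_le (c : cube n) t (alpha : 'I_k -> 'rV[R]_n) :
  TT t -> unit_tuples alpha ->
  \sum_i chaos_grad t (signs R c) alpha i ^+ 2 <= chaosW TT k.+1 (signs R c) ^+ 2.
Proof.
move=> tT aA; set v := chaos_grad _ _ _; set W := chaosW _ _ _.
have W0 : 0 <= W by exact: chaosW_ge0.
have S0 : 0 <= \sum_i v i ^+ 2 by apply: sumr_ge0 => i _; exact: sqr_ge0.
set s := Num.sqrt (\sum_i v i ^+ 2).
have s2 : \sum_i v i ^+ 2 = s ^+ 2 by rewrite sqr_sqrtr.
have [s0|sn0] := eqVneq s 0; first by rewrite s2 s0 expr0n sqr_ge0.
have sp : 0 < s by rewrite lt_neqAle eq_sym sn0 sqrtr_ge0.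
rewrite s2 lerXn2r ?nnegrE ?(ltW sp)//.
pose beta : 'rV[R]_n := \row_i (v i / s).
have b1 : norm2 beta <= 1.
  rewrite /norm2 (eq_bigr (fun i => v i ^+ 2 * s ^- 2)).
    by rewrite -mulr_suml s2 mulfV ?expf_neq0// sqrtr1.
  by move=> i _; rewrite mxE exprMn exprVn.
have := chaosW_ge T0 cT c tT (cons_tuple_unit b1 aA).
rewrite chaos_form_cons (eq_bigr (fun i => v i ^+ 2 * s^-1)); last first.
  by move=> i _; rewrite mxE mulrAC -expr2.
rewrite -mulr_suml s2 expr2 mulfK//; apply: le_trans; exact: ler_norm.
Qed.

(** At a near-maximizing form for W_k(c), the increment W_k(c) - W_k(flip i c) is
    at most h plus the increment of the form, which is twice an entry of the
    gradient; then h tends to 0. *)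
Lemma upvar_chaosW (c : cube n) :
  upvar (fun c => chaosW TT k (signs R c)) c <= 2 * chaosW TT k.+1 (signs R c) ^+ 2.
Proof.
rewrite /upvar; set W := chaosW TT k.+1 _.
pose u (i : 'I_n) : R :=
  Num.max (chaosW TT k (signs R c) - chaosW TT k (signs R (flip i c))) 0.
suff uW : \sum_i u i ^+ 2 <= 4 * W ^+ 2.
  suff : 2^-1 * \sum_i u i ^+ 2 <= 2 * W ^+ 2 by [].
  lra.
have W0 : 0 <= W by exact: chaosW_ge0.
apply/ler_addgt0Pl => e e0.
(* Squaring 2 |v_i| + h costs at most h (4 W + 1) for each of the n coordinates;
   the leading 1 makes C positive. *)
pose C := 1 + n%:R * (4 * W + 1).
have C0 : 0 < C by rewrite /C ltr_pwDl// mulr_ge0//; lra.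
pose h := Num.min 1 (e / C).
have h0 : 0 < h by rewrite lt_min ltr01 divr_gt0.
have h1 : h <= 1 by rewrite ge_min lexx.
have hC : h * C <= e by rewrite -ler_pdivlMr// ge_min lexx orbT.
have [t [tT [alpha [aA ht]]]] := chaosW_approx k T0 cT c h0.
pose v := chaos_grad t (signs R c) alpha.
have vW := chaos_grad_norm_le c tT aA; rewrite -/W -/v in vW.
have vi i : `|v i| <= W.
  rewrite -(@ler_pXn2r _ 2) ?nnegrE// real_normK ?num_real//.
  apply: le_trans vW; rewrite (bigD1 i)//= lerDl.
  by apply: sumr_ge0 => j _; exact: sqr_ge0.
have ui i : u i ^+ 2 <= 4 * v i ^+ 2 + h * (4 * W + 1).
  have u0 : 0 <= u i by rewrite /u le_max lexx orbT.
  have uv : u i <= 2 * `|v i| + h.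
    rewrite /u ge_max addr_ge0 ?mulr_ge0 ?(ltW h0)// andbT.
    have := chaosW_ge T0 cT (flip i c) tT aA.
    have := ler_dist_dist (chaos_form (signs R c) t alpha)
      (chaos_form (signs R (flip i c)) t alpha).
    rewrite chaos_form_flip// !normrM -/v ger0_norm// normrX normrN1 expr1n mul1r.
    move=> /(le_trans (ler_norm _)); lra.
  have : u i ^+ 2 <= (2 * `|v i| + h) ^+ 2.
    by rewrite lerXn2r ?nnegrE ?addr_ge0 ?mulr_ge0 ?(ltW h0).
  move=> /le_trans; apply; rewrite sqrrD exprMn real_normK ?num_real//.
  have := ler_wpM2l (ltW h0) (vi i); have := ler_wpM2l (ltW h0) h1.
  rewrite -!mulrnAr !expr2; lra.
apply: le_trans (ler_sum _ (fun i _ => ui i)) _.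
rewrite big_split -mulr_sumr sumr_const card_ord -mulr_natl /=.
rewrite addrC lerD ?ler_wpM2l//; apply: le_trans hC.
rewrite /C; nra.
Qed.

End self_bounding.

Section minkowski.
Variables (R : realType) (n : nat) (W : cube n -> R).
Hypothesis W0 : forall c, 0 <= W c.

(** Minkowski's inequality for W <= E W + (W - E W)_+, proved by expanding
    W^q = W W^(q-1) and applying Hoelder's inequality to each term. *)
Lemma norm_le_avg_excess (q : R) : 2 <= q ->
  avg (fun c => W c `^ q) `^ q^-1 <=
    avg W + avg (fun c => excess W c `^ q) `^ q^-1.
Proof.
move=> q2; have q0 : 0 < q by lra.
set S := avg (fun c => W c `^ q); set m := avg W.
set x := avg (fun c => excess W c `^ q) `^ _.
have S0 : 0 <= S by apply: avg_ge0 => c; exact: powR_ge0.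
have m0 : 0 <= m by exact: avg_ge0.
have x0 : 0 <= x by exact: powR_ge0.
have [->|Sn0] := eqVneq S 0.
  by rewrite powR0 ?invr_eq0 ?gt_eqF// addr_ge0.
have Sp : 0 < S by rewrite lt_neqAle eq_sym Sn0.
have Spp : 0 < S `^ (1 - q^-1) by rewrite powR_gt0.
have t01 : 0 <= q^-1 <= 1 by rewrite invr_ge0 (ltW q0)/= invf_le1//; lra.
rewrite -(ler_pM2r Spp) -powRD ?subrKC ?oner_eq0// powRr1//.
have -> : (m + x) * S `^ (1 - q^-1) = m * S `^ (1 - q^-1) + x * S `^ (1 - q^-1).
  exact: mulrDl.
apply: (@le_trans _ _ (m * avg (fun c => W c `^ (q - 1))
   + avg (fun c => excess W c * W c `^ (q - 1)))).
  rewrite -avgZ -avgD; apply: ler_avg => c.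
  rewrite -mulrDl -{1}(mulr_powRB1 (W0 c) q0) ler_wpM2r ?powR_ge0//.
  by rewrite -lerBlDl /excess le_max lexx.
have qE : (q - 1) / q = 1 - q^-1 by field; rewrite gt_eqF.
rewrite lerD//.
  rewrite -qE; apply: (ler_wpM2l m0).
  by apply: (avg_powR_le _ W0); apply/andP; split; lra.
apply: le_trans (avg_hoelder t01 (fun c => powR_ge0 _ _) (fun c => powR_ge0 _ _)).
apply: ler_avg => c; rewrite -!powRrM mulfV ?gt_eqF// powRr1 ?excess_ge0//.
by rewrite -qE mulrCA mulfV ?gt_eqF// mulr1.
Qed.

End minkowski.

(** Unrolling the recursive inequality from 0 up to d - 1, where u is bounded
    by B. *)
Lemma iterate_bound (R : realType) (d : nat) (a B : R) (u w : nat -> R) :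
  0 <= a -> (forall k, (k.+1 < d)%N -> u k <= a * (w k.+1 + u k.+1)) ->
  u d.-1 <= B -> (0 < d)%N ->
  u 0%N <= \sum_(1 <= j < d) a ^+ j * w j + a ^+ d.-1 * B.
Proof.
move=> a0 step uB d0.
(* Start at an arbitrary k, with m = d - 1 - k steps left. *)
suff H m k : (k + m).+1 = d ->
    u k <= \sum_(0 <= j < m) a ^+ j.+1 * w (k + j.+1)%N + a ^+ m * B.
  have := H d.-1 0%N; rewrite add0n prednK// => /(_ erefl) /le_trans; apply.
  by rewrite -{2}(prednK d0) big_add1 /=.
elim: m k => [|m IH] k km.
  by rewrite big_geq// expr0 mul1r add0r; move: uB; rewrite -km addn0.
apply: le_trans (step k _) _; first by rewrite -km addnS !ltnS leq_addr.
rewrite big_nat_recl// expr1 addn1 -addrA mulrDr lerD2l exprS.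
have := IH k.+1; rewrite addSnnS => /(_ km) /(ler_wpM2l a0) /le_trans; apply.
rewrite mulrDr mulr_sumr mulrA lerD2r; apply: ler_sum => i _.
by rewrite mulrA -exprS addSnnS.
Qed.

Section cube_bound.
Variables (R : realType) (n d : nat) (TT : set (coefs R n d)) (q : R).
Hypotheses (T0 : TT !=set0) (cT : compact TT) (q2 : 2 <= q).

Let W k : cube n -> R := fun c => chaosW TT k (signs R c).
Let excess_norm k := avg (fun c => excess (W k) c `^ q) `^ q^-1.

Let q0 : 0 < q. Proof. by move: q2; lra. Qed.
Let kq0 : 0 <= 4 * kappa R * q.
Proof. by have := two_kappa_ge1 R; move: q2; nra. Qed.
Let W0 k c : 0 <= W k c. Proof. exact: chaosW_ge0. Qed.

Let powR_q_half (x : R) : x `^ (q / 2) `^ q^-1 = x `^ 2^-1.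
Proof. by rewrite -powRrM mulrAC mulfV ?mul1r// gt_eqF. Qed.

Lemma excess_chaosW_le k : (k < d)%N ->
  excess_norm k <=
    (4 * kappa R * q) `^ 2^-1 * avg (fun c => W k.+1 c `^ q) `^ q^-1.
Proof.
move=> kd.
have avg0 : 0 <= avg (fun c => W k.+1 c `^ q).
  by apply: avg_ge0 => c; exact: powR_ge0.
have V0 : 0 <= avg (fun c => upvar (W k) c `^ (q / 2)).
  by apply: avg_ge0 => c; exact: powR_ge0.
have H : avg (fun c => excess (W k) c `^ q) <=
    (4 * kappa R * q) `^ (q / 2) * avg (fun c => W k.+1 c `^ q).
  apply: le_trans (excess_moment_upvar (W0 k) (k := Num.truncn q) _ q2 (lexx q)) _.
    by have := truncnS_gt q; rewrite -natr1; move: q2; lra.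
  rewrite divff ?gt_eqF// powRr1//.
  have -> : 4 * kappa R * q = 2 * kappa R * q * 2 by ring.
  rewrite [leRHS in _ <= leRHS * _]powRM//; last first.
    by have := two_kappa_ge1 R; move: q2; nra.
  rewrite -[leRHS]mulrA ler_wpM2l ?powR_ge0// -avgZ; apply: ler_avg => c.
  apply: (@le_trans _ _ ((2 * W k.+1 c ^+ 2) `^ (q / 2))).
    apply: powR_le; [by rewrite divr_ge0// ltW|exact: upvar_ge0|].
    exact: upvar_chaosW.
  rewrite powRM ?sqr_ge0// ler_wpM2l ?powR_ge0// -powR_mulrn// -powRrM.
  by rewrite mulrCA mulfV ?mulr1.
rewrite /excess_norm -powR_q_half -powRM ?powR_ge0//.
apply: powR_le => //; first by rewrite invr_ge0 ltW.
by apply: avg_ge0 => c; exact: powR_ge0.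
Qed.

Lemma excess_chaosW_top c : (0 < d)%N ->
  excess_norm d.-1 <= Num.sqrt (2 * Kconst R) * q `^ 2^-1 * W d c.
Proof.
move=> d0; have K9 := Kconst_ge R.
have UW c' : upvar (W d.-1) c' <= 2 * W d c ^+ 2.
  have := @upvar_chaosW R n d d.-1 TT T0 cT ltac:(by rewrite prednK) c'.
  by rewrite prednK// (chaosW_top TT (signs R c') (signs R c)).
have H := excess_moment_bounded (W0 d.-1) UW (ltac:(move: q2; lra) : 1 <= q).
apply: (@le_trans _ _ ((Kconst R * q * (2 * W d c ^+ 2)) `^ (q / 2) `^ q^-1)).
  apply: powR_le => //; first by rewrite invr_ge0 ltW.
  by apply: avg_ge0 => c'; exact: powR_ge0.
rewrite powR_q_half.
have -> : Kconst R * q * (2 * W d c ^+ 2) = 2 * Kconst R * q * W d c ^+ 2 by ring.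
have K0 : 0 <= 2 * Kconst R by lra.
have Kq0 : 0 <= 2 * Kconst R * q by rewrite mulr_ge0// ltW.
rewrite powRM ?sqr_ge0// powRM ?(ltW q0)// powR12_sqrt//.
by rewrite -powR_mulrn// -powRrM mulfV// powRr1.
Qed.

(** The theorem for averages over the cube, with a = sqrt(4 kappa q) as the ratio
    between consecutive terms. *)
Lemma cube_moment_bound c : (0 < d)%N ->
  excess_norm 0 <= \sum_(1 <= j < d) (4 * kappa R * q) `^ (j%:R / 2) * avg (W j)
    + (4 * kappa R) `^ ((d%:R - 1) / 2) * Num.sqrt (2 * Kconst R)
            * q `^ (d%:R / 2) * W d c.
Proof.
move=> d0; set a := (4 * kappa R * q) `^ 2^-1.
have aE j : (4 * kappa R * q) `^ (j%:R / 2) = a ^+ j.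
  by rewrite -powR_mulrn ?powR_ge0// /a -powRrM [2^-1 * _]mulrC.
under eq_bigr do rewrite aE.
have -> : (4 * kappa R) `^ ((d%:R - 1) / 2) * Num.sqrt (2 * Kconst R)
    * q `^ (d%:R / 2) * W d c =
    a ^+ d.-1 * (Num.sqrt (2 * Kconst R) * q `^ 2^-1 * W d c).
  have -> : d%:R = d.-1%:R + 1 :> R by rewrite natr1 prednK.
  have k0 : 0 <= 4 * kappa R by have := two_kappa_ge1 R; lra.
  have -> : (d.-1%:R + 1) / 2 = d.-1%:R / 2 + 2^-1 :> R by field.
  rewrite addrK powRD; last by rewrite gt_eqF// implybT.
  rewrite -aE [(4 * kappa R * q) `^ _]powRM ?(ltW q0)//; ring.
apply: (@iterate_bound R d a _ excess_norm (fun j => avg (W j))) => //.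
- exact: powR_ge0.
- move=> k kd; apply: le_trans (excess_chaosW_le (ltnW kd)) _.
  by rewrite ler_wpM2l ?powR_ge0// norm_le_avg_excess.
- exact: excess_chaosW_top.
Qed.

End cube_bound.

(** * From the probability space to the cube *)

Section full_measure.
Import HBNNSimple.

(** A function of the X_i takes finitely many values on the event that all X_i are
    signs, but is arbitrary elsewhere.  The integrals are therefore compared
    through their definition as suprema over simple functions: restricting a
    simple function to a set of full measure does not change its integral. *)
Lemma ge0_integral_full_le (dO : measure_display) (O : measurableType dO)
    (R : realType) (mu : {measure set O -> \bar R}) (D : set O) (f g : O -> \bar R) :
  measurable D -> mu (~` D) = 0%E ->
  (forall x, 0 <= f x)%E -> (forall x, 0 <= g x)%E ->
  (forall x, D x -> f x <= g x)%E ->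
  (\int[mu]_x f x <= \int[mu]_x g x)%E.
Proof.
move=> mD D0 f0 g0 fg; rewrite !ge0_integralTE//.
apply: ge_ereal_sup => _ [h /= hf <-].
have <- : sintegral mu (proj_nnsfun h mD) = sintegral mu h.
  have <- : (\int[mu]_x (h x)%:E)%E = sintegral mu h.
    by rewrite integral_nnsfun// patch_setT.
  rewrite (@ge0_negligible_integral _ _ _ mu setT (~` D) (fun x => (h x)%:E))//.
  - by rewrite setTD setCK integral_nnsfun// mrestrict.
  - exact: measurableC.
  - exact/measurable_EFinP.
  - by move=> x _; rewrite lee_fin.
apply: ereal_sup_ubound; exists (proj_nnsfun h mD) => //= x.
have [xD|xD] := pselect (D x).
  rewrite mindicE mem_set// mulr1; exact: le_trans (hf x) (fg x xD).
by rewrite mindicE memNset// mulr0.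
Qed.

Lemma ge0_integral_full_eq (dO : measure_display) (O : measurableType dO)
    (R : realType) (mu : {measure set O -> \bar R}) (D : set O) (f g : O -> \bar R) :
  measurable D -> mu (~` D) = 0%E ->
  (forall x, 0 <= f x)%E -> (forall x, 0 <= g x)%E ->
  (forall x, D x -> f x = g x) ->
  (\int[mu]_x f x = \int[mu]_x g x)%E.
Proof.
by move=> mD D0 f0 g0 fg; apply/eqP; rewrite eq_le;
  apply/andP; split; apply: (ge0_integral_full_le mD D0) => // x /fg ->.
Qed.

End full_measure.

Section rademacher.
Variables (R : realType) (dO : measure_display) (O : measurableType dO).
Variables (P : probability O R) (n : nat) (X : 'I_n -> {RV P >-> R}).
Hypotheses (rX : forall i, rademacher_RV (X i)) (iX : independent_RVs X).

Let fib (c : cube n) : set O :=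
  \bigcap_(i in [set` [set: 'I_n]%SET]) (X i @^-1` [set signs R c i]).

Let fibP c w : fib c w <-> (fun i => X i w) = signs R c.
Proof.
split=> [H|H i _]; last by rewrite /= -H.
by apply/funext => i; apply: H; rewrite /= inE.
Qed.

Let measurable_level i (a : R) : measurable (X i @^-1` [set a]).
Proof. by rewrite -[_ @^-1` _]setTI; exact: measurable_funP. Qed.

Let measurable_fib c : measurable (fib c).
Proof. by apply: fin_bigcap_measurable => // i _; exact: measurable_level. Qed.

Let probability_fib c : P (fib c) = ((2 ^+ n)^-1)%:E.
Proof.
rewrite /fib (iX [set: 'I_n]%SET (B := fun i => [set signs R c i]))//.
rewrite (eq_bigr (fun=> (2^-1)%:E)).
  by rewrite prodEFin prodr_const finset.cardsT card_ord exprVn.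
move=> i _; have [h1 h2] := rX i; rewrite /signs; case: (c i).
  by rewrite expr1.
by rewrite expr0.
Qed.

Let fib_sum (f : ('I_n -> R) -> R) w c : fib c w ->
  \sum_c' f (signs R c') * \1_(fib c') w = f (fun i => X i w).
Proof.
move=> cw; rewrite (bigD1 c)//= indicE mem_set// mulr1 big1 ?addr0.
  by have /fibP -> := cw.
move=> c' c'c; rewrite indicE memNset ?mulr0// => /fibP; have /fibP -> := cw.
move=> E; move/eqP: c'c; apply; apply/ffunP => i; apply: (@signr_inj R).
by have /(congr1 (@^~ i)) := E.
Qed.

Let integral_fib_sum (f : ('I_n -> R) -> R) : (forall x, 0 <= f x) ->
  (\int[P]_w (\sum_c f (signs R c) * \1_(fib c) w)%:E =
   (avg (fun c => f (signs R c)))%:E)%E.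
Proof.
move=> f0; under eq_integral do rewrite -sumEFin.
rewrite ge0_integral_sum//; last 2 first.
- by move=> c; apply/measurable_EFinP; apply: measurable_funM => //.
- by move=> c w _; rewrite lee_fin mulr_ge0.
rewrite /avg mulr_sumr -sumEFin; apply: eq_bigr => c _.
under eq_integral do rewrite EFinM.
rewrite ge0_integralZl_EFin//; last by apply/measurable_EFinP.
have -> : (\int[P]_w (\1_(fib c) w)%:E = ((2 ^+ n)^-1)%:E)%E.
  by rewrite integral_indic// setIT; exact: probability_fib.
by rewrite -EFinM mulrC.
Qed.

Let full : set O := \bigcup_c (fib c).

Let measurable_full : measurable full.
Proof. by apply: fin_bigcup_measurable => // c _; exact: measurable_fib. Qed.

Let prob_full : P (~` full) = 0%E.
Proof.
rewrite probability_setC//.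
suff -> : P full = 1%E by rewrite subee.
rewrite -[full]setIT -integral_indic//.
rewrite -[1%E in RHS](_ : (avg (fun c : cube n => 1))%:E = _); last first.
  by rewrite avg_cst.
rewrite -(@integral_fib_sum (fun=> 1))//; apply: eq_integral => w _.
have [[c _ cw]|nw] := pselect (full w).
  by rewrite (fib_sum (fun=> 1) cw) indicE mem_set//; exists c.
rewrite indicE memNset// big1// => c _.
by rewrite indicE memNset ?mulr0// => cw; apply: nw; exists c.
Qed.

(** On an event of full measure exactly one of the 2^n sign patterns occurs, and
    each has probability 2^(-n) by independence. *)
Lemma integral_rademacher (f : ('I_n -> R) -> R) : (forall x, 0 <= f x) ->
  (\int[P]_w (f (fun i => X i w))%:E = (avg (fun c => f (signs R c)))%:E)%E.
Proof.
move=> f0; rewrite -integral_fib_sum//.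
apply: (ge0_integral_full_eq measurable_full prob_full).
- by move=> w; rewrite lee_fin.
- by move=> w; rewrite lee_fin sumr_ge0// => c _; rewrite mulr_ge0.
- by move=> w [c _ cw]; rewrite (fib_sum f cw).
Qed.

End rademacher.

(** * Conclusion *)

(** Indeed 1/K = e (1 - e^(-1/2)) and 1/(2 kappa) = 1 - e^(-1/2). *)
Lemma Kconst_le_two_kappa (R : realType) : Kconst R <= 2 * kappa R.
Proof.
rewrite -[Kconst R]invrK invr_KconstE two_kappaE.
have s1 : 0 < 1 - expR (- 2^-1) :> R by rewrite subr_gt0 expR_lt1; lra.
rewrite lef_pV2 ?posrE ?mulr_gt0 ?expR_gt0// ler_peMl ?(ltW s1)//.
by rewrite -expR0 ler_expR.
Qed.

Lemma top_coefficient_le (R : realType) (d : nat) (q : R) : 2 <= q ->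
  (4 * kappa R) `^ ((d%:R - 1) / 2) * Num.sqrt (2 * Kconst R) * q `^ (d%:R / 2)
  <= (4 * kappa R * q) `^ (d%:R / 2).
Proof.
move=> q2; have k1 := two_kappa_ge1 R; have Kk := Kconst_le_two_kappa R.
have k0 : 0 < 4 * kappa R by lra.
rewrite [leRHS]powRM ?(ltW k0)//; last by lra.
rewrite ler_wpM2r ?powR_ge0//.
have -> : d%:R / 2 = (d%:R - 1) / 2 + 2^-1 :> R by field.
rewrite [leRHS]powRD; last by apply/implyP => _; rewrite gt_eqF.
rewrite ler_wpM2l ?powR_ge0// powR12_sqrt ?(ltW k0)// ler_wsqrtr//; lra.
Qed.

(* MathComp-Analysis. W d is deterministic (d - d = 0, so only J = set0 occurs
   and no x j is used); "forall w" only serves to evaluate this constant. *)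
Theorem theorem14 (R : realType) (dO : measure_display) (O : measurableType dO)
    (P : probability O R) (n d : nat) (X : 'I_n -> {RV P >-> R})
    (TT : set (coefs R n d)) (q : R) :
  (1 <= d)%N -> (d < n)%N ->
  (forall i, rademacher_RV (X i)) ->
  independent_RVs X ->
  TT !=set0 -> compact TT ->
  2 <= q ->
  let Z : O -> R := fun w => chaosZ TT (fun i => X i w) in
  let W : nat -> O -> R := fun k w => chaosW TT k (fun i => X i w) in
  forall w : O,
    ('N[P]_(q%:E)[(fun w' => (Z w')%:E - 'E_P[Z])^\+]
      <= \sum_(1 <= j < d) ((4 * kappa R * q) `^ (j%:R / 2))%:E * 'E_P[W j]
         + ((4 * kappa R) `^ ((d%:R - 1) / 2) * Num.sqrt (2 * Kconst R)
            * q `^ (d%:R / 2))%:E * (W d w)%:E)%E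
    /\
    (\sum_(1 <= j < d) ((4 * kappa R * q) `^ (j%:R / 2))%:E * 'E_P[W j]
         + ((4 * kappa R) `^ ((d%:R - 1) / 2) * Num.sqrt (2 * Kconst R)
            * q `^ (d%:R / 2))%:E * (W d w)%:E
      <= \sum_(1 <= j < d.+1) ((4 * kappa R * q) `^ (j%:R / 2))%:E * 'E_P[W j])%E.
Proof.
move=> d0 dn rX iX T0 cT q2 Z W w.
pose Wc j (c : cube n) := chaosW TT j (signs R c).
have EW j : ('E_P[W j] = (avg (Wc j))%:E)%E.
  rewrite expectation.unlock.
  apply: (integral_rademacher rX iX (f := chaosW TT j)) => x; exact: chaosW_ge0.
have EZ : ('E_P[Z] = (avg (Wc 0%N))%:E)%E.
  by rewrite -EW; congr expectation; apply/funext => v; exact: chaosZ_W0.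
have Wd c : W d w = Wc d c by exact: chaosW_top.
have sumE m :
  (\sum_(1 <= j < m) ((4 * kappa R * q) `^ (j%:R / 2))%:E * 'E_P[W j] =
    (\sum_(1 <= j < m) (4 * kappa R * q) `^ (j%:R / 2) * avg (Wc j))%:E)%E.
  by rewrite -sumEFin; apply: eq_bigr => j _; rewrite EW -EFinM.
split.
  have -> : ('N[P]_(q%:E)[(fun w' => (Z w')%:E - 'E_P[Z])^\+] =
      (avg (fun c => excess (Wc 0%N) c `^ q) `^ q^-1)%:E)%E.
    rewrite EZ Lnorm.unlock -poweR_EFin; congr (_ `^ _)%E.
    pose f x : R := Num.max (chaosW TT 0 x - avg (Wc 0%N)) 0 `^ q.
    rewrite -(integral_rademacher rX iX (f := f)); last first.
      by move=> x; exact: powR_ge0.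
    apply: eq_integral => v _; rewrite /f -poweR_EFin; congr (_ `^ _)%E.
    rewrite funeposE gee0_abs ?le_max ?lexx ?orbT// /Z chaosZ_W0.
    by rewrite -EFinB -EFin_max.
  pose c0 : cube n := [ffun=> true].
  rewrite sumE (Wd c0) -EFinM -EFinD lee_fin.
  exact: cube_moment_bound.
rewrite [leRHS]sumE big_nat_recr// sumE -EFinM -EFinD lee_fin lerD2l.
have -> : avg (Wc d) = W d w.
  rewrite -(@avg_cst R n (W d w)); apply: eq_avg => c.
  exact/esym/Wd.
by rewrite ler_wpM2r ?chaosW_ge0// top_coefficient_le.
Qed.
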